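(* Given integers $n\geq1$, $d\geq 2$, $s\geq n+3$, $d\ge m_1\ge \ldots\ge m_s\ge 1$, consider $\mathcal{L}=\mathcal{L}_{n,d}(m_1,\dots,m_s)$. Let $s(d)\geq0$ be the number of points of multiplicity $d$ (i.e. $m_{s(d)}= d$ and $m_{s(d)+1}\le d-1$), and define $b(\mathcal{L}):=\min \{n-s(d),s-n-2\}$. Then $\dim(\mathcal{L})=\operatorname{ldim}(\mathcal{L})$ provided \[ \sum_{i=1}^s m_i\leq nd+ b(\mathcal{L}). \]
   Context: $\mathcal{L}_{n,d}(m_1,\dots,m_s)$ denotes the linear system of degree-$d$ hypersurfaces in $\mathbb{P}^n$ through $s$ general points with multiplicities $m_1,\dots,m_s$; $\dim$ is its projective dimension. For $-1\le r\le s-1$ and $I(r)=\{i_1,\dots,i_{r+1}\}\subseteq\{1,\dots,s\}$ ($I(-1)=\emptyset$) put $k_{I(r)}=\max(m_{i_1}+\dots+m_{i_{r+1}}-rd,0)$. The linear virtual dimension is $\sum_{r=-1}^{s-1}\sum_{I(r)}(-1)^{r+1}\binom{n+k_{I(r)}-r-1}{n}-1$; the linear expected dimension $\operatorname{ldim}(\mathcal{L})$ is $-1$ if $\mathcal{L}$ is contained in a linear system of negative linear virtual dimension, otherwise the maximum of the linear virtual dimension and $-1$. *)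

(* Defs.v *)
From HB Require Import structures.
From mathcomp Require Import all_boot all_order all_algebra.
From mathcomp Require Import mpoly.
Set Implicit Arguments. Unset Strict Implicit. Unset Printing Implicit Defensive.
Import Order.TTheory GRing.Theory Num.Theory.
Local Open Scope ring_scope.

(* P vanishes to order >= mu at the (affine representative) a of a point of
   P^n : all partial derivatives of P of order < mu vanish at a. *)
Definition vanishes_to_order (K : fieldType) (n : nat) (P : {mpoly K[n.+1]})
    (a : 'I_n.+1 -> K) (mu : nat) : Prop :=
  forall mm : 'X_{1..n.+1}, (mdeg mm < mu)%N -> (mderivm mm P).@[a] = 0.

Definition in_linsys (K : fieldType) (n d s : nat) (m : 'I_s -> nat)
    (pts : 'I_s -> 'I_n.+1 -> K) (P : {mpoly K[n.+1]}) : Prop :=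
  P \is d.-homog /\ forall i, vanishes_to_order P (pts i) (m i).

Definition has_indep (K : fieldType) (n d s : nat) (m : 'I_s -> nat)
    (pts : 'I_s -> 'I_n.+1 -> K) (k : nat) : Prop :=
  exists Ps : 'I_k -> {mpoly K[n.+1]},
    (forall j, in_linsys d m pts (Ps j)) /\
    (forall c : 'I_k -> K, \sum_(j < k) c j *: Ps j = 0 -> forall j, c j = 0).

(* projective dimension of the linear system at given points equals D *)
Definition linsys_dim_at (K : fieldType) (n d s : nat) (m : 'I_s -> nat)
    (pts : 'I_s -> 'I_n.+1 -> K) (D : int) : Prop :=
  exists k : nat, D = k%:Z - 1 /\ has_indep d m pts k /\ ~ has_indep d m pts k.+1.

(* Configurations of s points are parametrized by v : K^(s*(n+1)); point i has
   coordinates j |-> v (mxvec_index i j).  "dim L_{n,d}(m) = D" (for general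
   points) means: there is a nonzero polynomial G in the s*(n+1) coordinates
   such that the dimension is D at every configuration where G does not vanish
   (i.e. on a nonempty Zariski open set). *)
Definition pts_of (K : fieldType) (n s : nat) (v : 'I_(s * n.+1) -> K) :
    'I_s -> 'I_n.+1 -> K := fun i j => v (mxvec_index i j).

Definition general_dim (K : fieldType) (n d s : nat) (m : 'I_s -> nat)
    (D : int) : Prop :=
  exists G : {mpoly K[s * n.+1]}, G != 0 /\
    forall v : 'I_(s * n.+1) -> K, G.@[v] != 0 ->
      linsys_dim_at d m (@pts_of K n s v) D.

Definition binz (a : int) (b : nat) : nat :=
  match a with Posz a' => 'C(a', b) | Negz _ => 0%N end.

Definition kI (d s : nat) (m : 'I_s -> nat) (I : {set 'I_s}) : int :=
  Num.max ((\sum_(i in I) (m i)%:Z) - (#|I|%:Z - 1) * d%:Z) 0.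

(* linear virtual dimension: sum over all subsets I (r = #|I| - 1) of
   (-1)^(r+1) binom(n + k_I - r - 1, n), minus 1 *)
Definition ldim_virt (n d s : nat) (m : 'I_s -> nat) : int :=
  (\sum_(I : {set 'I_s}) (-1) ^+ #|I| * (binz (n%:Z + kI d m I - #|I|%:Z) n)%:Z) - 1.

(* L_{n,d}(m) is contained in a linear system of negative linear virtual
   dimension: a system L_{n,d}(m') with m'_i <= m_i (m'_i = 0 = point dropped) *)
Definition contained_in_negative (n d s : nat) (m : 'I_s -> nat) : Prop :=
  exists m' : 'I_s -> nat, (forall i, (m' i <= m i)%N) /\ ldim_virt n d m' < 0.

(* linear expected dimension, as a relation (the case split is on a Prop) *)
Definition is_ldim (n d s : nat) (m : 'I_s -> nat) (D : int) : Prop :=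
  (contained_in_negative n d m /\ D = -1) \/
  (~ contained_in_negative n d m /\ D = Num.max (ldim_virt n d m) (-1)).

(* Main.v *)
Require Import Defs.
From HB Require Import structures.
From mathcomp Require Import all_boot all_order all_algebra.
From mathcomp Require Import mpoly.
From mathcomp Require Import zify ring.
Import Order.TTheory GRing.Theory Num.Theory.
Set Implicit Arguments. Unset Strict Implicit. Unset Printing Implicit Defensive.
Local Open Scope ring_scope.

(** A form [f] of degree [d] vanishes to order [m_i] at [p_i] iff
    [D_(p_i)^(a_i) f = 0], where [a_i = d + 1 - m_i] and [D_p] is the derivative
    in the direction [p].  In these terms the linear virtual dimension plus one
    is the coefficient [F(d; a)] of [t^d] in [\prod (1 - t^(a_i)) / (1 - t)^(n+1)],
    and the theorem says that the space [V(d; a)] of such forms has dimension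
    [F(d; a)] at general points.  Dimensions are upper semicontinuous, so it is
    enough to bound [dim V(d; a)] from below in general and from above at one
    configuration, by induction on [n], [d] and the number of points.

    Lower bound: [D_(p_x)^(a_x)] maps [V(d; a)] without the point [x] to the
    same system in degree [d - a_x], with kernel [V(d; a)], and [F] satisfies
    the corresponding equality.

    Upper bound, three moves:
    - put all points but [i], [j] on a hyperplane [H]; restriction to [H] has
      values in a system where [i], [j] are replaced by the single point
      [H \cap <p_i, p_j>] with exponent [a_i + a_j - 1], and its kernel is [H]
      times a system of degree [d - 1].  This works if some [m_i = d], or if
      [m_i + m_j > d] and [\sum m < n (d + 1)];
    - if [x] has least multiplicity and [H] is the hyperplane through the [n]
      points of largest multiplicity, multiplication by [H] shows that [x]
      imposes on [V(d; a)] at least as many conditions as on the residual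
      system of degree [d - 1]; the two numbers agree when [m_x + m_c <= d] for
      all points [c] off [H];
    - a general simple point imposes one condition on a nonzero system.
    The numerical hypothesis is what makes one of these moves available. *)

(** * Directional derivatives *)

Section DirectionalDerivative.
Variables (K : fieldType) (n : nat).
Implicit Types (p q r : 'I_n -> K) (f g h : {mpoly K[n]}).

Definition ddir p f : {mpoly K[n]} := \sum_j p j *: f^`M(j).

Lemma ddir_is_linear p : linear (ddir p).
Proof.
move=> c f g; rewrite /ddir scaler_sumr -big_split /=; apply: eq_bigr => j _.
by rewrite linearP scalerDr !scalerA mulrC.
Qed.

HB.instance Definition _ p :=
  GRing.isLinear.Build K {mpoly K[n]} {mpoly K[n]} _ (ddir p) (ddir_is_linear p).

Definition dder p k f := iter k (ddir p) f.

Lemma dderSr p k f : dder p k.+1 f = ddir p (dder p k f).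
Proof. by []. Qed.

Lemma dder_is_linear p k : linear (dder p k).
Proof. by elim: k => // k IHk c f g; rewrite !dderSr IHk linearP. Qed.

HB.instance Definition _ p k :=
  GRing.isLinear.Build K {mpoly K[n]} {mpoly K[n]} _ (dder p k)
    (dder_is_linear p k).

Lemma dderZ p k c f : dder p k (c *: f) = c *: dder p k f.
Proof. exact: linearZ. Qed.

Lemma dderS p k f : dder p k.+1 f = dder p k (ddir p f).
Proof. by rewrite /dder iterSr. Qed.

Lemma dder_add p k l f : dder p (k + l) f = dder p k (dder p l f).
Proof. by rewrite /dder iterD. Qed.

Lemma dder_eq0_leq p k l f : (k <= l)%N -> dder p k f = 0 -> dder p l f = 0.
Proof. by move=> /subnK <- f0; rewrite dder_add f0 linear0. Qed.

Lemma mderiv_ddir i p f : (ddir p f)^`M(i) = ddir p (f^`M(i)).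
Proof.
rewrite /ddir raddf_sum /=; apply: eq_bigr => j _.
by rewrite linearZ /= mderiv_comm.
Qed.

Lemma mderivm_dder mm p k f : mderivm mm (dder p k f) = dder p k (mderivm mm f).
Proof.
elim: k => // k IHk; rewrite !dderSr -IHk; move: (dder p k f) => {IHk} {}f.
rewrite !mderivm_foldr; elim: (flatten _) => //= i s IHs.
by rewrite IHs mderiv_ddir.
Qed.

Lemma ddir_comm p q f : ddir p (ddir q f) = ddir q (ddir p f).
Proof.
rewrite {1}/ddir {3}/ddir raddf_sum; apply: eq_bigr => j _ /=.
by rewrite mderiv_ddir linearZ.
Qed.

Lemma dder_ddir p q k f : dder p k (ddir q f) = ddir q (dder p k f).
Proof. by elim: k => // k IHk; rewrite !dderSr IHk ddir_comm. Qed.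

Lemma dder_comm p q k l f : dder p k (dder q l f) = dder q l (dder p k f).
Proof. by elim: l => // l IHl; rewrite !dderSr dder_ddir IHl. Qed.

Lemma ddirM p f g : ddir p (f * g) = ddir p f * g + f * ddir p g.
Proof.
rewrite /ddir mulr_suml mulr_sumr -big_split; apply: eq_bigr => j _ /=.
by rewrite mderivM scalerDr scalerAl scalerAr.
Qed.

(** Leibniz: among [a + b - 1] derivatives either [a] fall on [f] or [b] fall on [g]. Peeling off
    one derivative at a time avoids binomial coefficients. *)
Lemma dder_mul0 p a b f g :
  dder p a f = 0 -> dder p b g = 0 -> dder p (a + b).-1 (f * g) = 0.
Proof.
have [c le_c] := ubnP (a + b); elim: c => // c IHc in a b f g le_c *.
case: a => [|a] in le_c *; first by move=> /= ->; rewrite mul0r linear0.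
case: b => [|b] in le_c *; first by move=> _ /= ->; rewrite mulr0 linear0.
move=> f0 g0; have -> : ((a.+1 + b.+1).-1 = (a + b.+1).-1.+1)%N by lia.
rewrite dderS ddirM linearD /=.
have -> : dder p (a + b.+1).-1 (ddir p f * g) = 0.
  by apply: IHc; rewrite -?dderS //; lia.
rewrite add0r; have -> : ((a + b.+1).-1 = (a.+1 + b).-1)%N by lia.
by apply: IHc; rewrite -?dderS //; lia.
Qed.

Lemma ddirB p q r f : (forall j, r j = q j - p j) ->
  ddir r f = ddir q f - ddir p f.
Proof.
move=> rE; rewrite /ddir -sumrB; apply: eq_bigr => j _.
by rewrite rE scalerBl.
Qed.

(** The operators [ddir p] and [ddir q] commute, and each term of [(D_q - D_p)^(a + b - 1)] contains
    [D_p^a] or [D_q^b]. This governs the point where a line through two fat points meets a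
    hyperplane. *)
Lemma dder_line0 p q r a b f : (forall j, r j = q j - p j) ->
  dder p a f = 0 -> dder q b f = 0 -> dder r (a + b).-1 f = 0.
Proof.
move=> rE; have [c le_c] := ubnP (a + b); elim: c => // c IHc in a b f le_c *.
case: a => [|a] in le_c *; first by move=> /= -> _; rewrite linear0.
case: b => [|b] in le_c *; first by move=> _ /= ->; rewrite linear0.
move=> p0 q0; have -> : ((a.+1 + b.+1).-1 = (a.+1 + b).-1.+1)%N by lia.
rewrite dderS (ddirB f rE) linearB /=.
have -> : dder r (a.+1 + b).-1 (ddir q f) = 0.
  by apply: IHc; rewrite -?dderS // ?dder_ddir ?p0 ?linear0 //; lia.
rewrite sub0r; have -> : (a + b = (a + b.+1).-1)%N by lia.
by rewrite IHc ?oppr0 // -?dderS // ?dder_ddir ?q0 ?linear0 //; lia.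
Qed.

(** The Leibniz expansion stops after two terms because the second derivative of [h] along [p] is
    zero. *)
Lemma dder_mulE p c h g k : ddir p h = c%:MP ->
  dder p k.+1 (h * g) = h * dder p k.+1 g + (c *+ k.+1) *: dder p k g.
Proof.
move=> hc; elim: k => [|k IHk].
  by rewrite !dderSr /= ddirM hc mul_mpolyC addrC mulr1n.
rewrite dderSr IHk linearD /= linearZ /= ddirM hc mul_mpolyC -!dderSr.
by rewrite [_ + h * _]addrC -addrA -scalerDl -mulrS.
Qed.

Lemma dhomog_mderiv d i f : f \is d.-homog -> f^`M(i) \is (d.-1).-homog.
Proof.
move=> fH; apply/dhomogP => mm; rewrite mcoeff_msupp mcoeff_mderiv => nz.
have : f@_(mm + U_(i)) != 0.
  by apply: contraNneq nz => ->; rewrite mul0rn.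
by rewrite -mcoeff_msupp => /(dhomog_mf fH) /=; rewrite mdegD mdeg1 => <-; lia.
Qed.

Lemma dhomog_ddir d p f : f \is d.-homog -> ddir p f \is (d.-1).-homog.
Proof.
by move=> fH; rewrite rpred_sum // => j _; rewrite rpredZ // dhomog_mderiv.
Qed.

Lemma dhomog_dder d p k f : f \is d.-homog -> dder p k f \is (d - k).-homog.
Proof.
move=> fH; elim: k => [|k IHk]; first by rewrite subn0.
by rewrite dderSr subnS dhomog_ddir.
Qed.

Lemma ddir_homog0 p f : f \is 0.-homog -> ddir p f = 0.
Proof.
move=> fH; apply: big1 => j _; apply/eqP; rewrite scaler_eq0; apply/orP; right.
apply/eqP/mpolyP => mm; rewrite mcoeff_mderiv mcoeff0.
by rewrite (dhomog_nemf_coeff fH) ?mul0rn //= mdegD mdeg1 addn1.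
Qed.

Lemma dder_gt_deg d p k f : f \is d.-homog -> (d < k)%N -> dder p k f = 0.
Proof.
move=> fH lt_dk; apply: (@dder_eq0_leq _ d.+1) => //.
by rewrite dderSr ddir_homog0 //; have := dhomog_dder p d fH; rewrite subnn.
Qed.

Lemma euler_homog d f : f \is d.-homog -> \sum_j 'X_j * f^`M(j) = d%:R *: f.
Proof.
move=> fH; rewrite {2}[f]mpolyE scaler_sumr.
under eq_bigr => j _ do rewrite {1}[f]mpolyE raddf_sum mulr_sumr.
rewrite exchange_big; apply: eq_big_seq => mm mmf /=.
under eq_bigr => j _ do rewrite linearZ /= mderivX -!scalerAr.
rewrite -(dhomog_mf fH mmf) /= mdegE natr_sum scaler_suml.
apply: eq_bigr => j _; rewrite !scalerA [_ * f@__]mulrC; case: (posnP (mm j)) => [->|mj].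
  by rewrite !mulr0 !scale0r.
by rewrite -mpolyXD addmC submK // lep1mP -lt0n.
Qed.

Lemma ddir_meval d p f : f \is d.-homog -> (ddir p f).@[p] = d%:R * f.@[p].
Proof.
move=> fH; rewrite -mevalZ -(euler_homog fH) !raddf_sum.
by apply: eq_bigr => j _ /=; rewrite mevalZ mevalM mevalXU.
Qed.

Lemma dder_meval d p k f : f \is d.-homog ->
  (dder p k f).@[p] = (d ^_ k)%:R * f.@[p].
Proof.
move=> fH; elim: k => [|k IHk]; first by rewrite ffactn0 mul1r.
rewrite dderSr (ddir_meval _ (dhomog_dder p k fH)) IHk mulrA -natrM.
by rewrite ffactnSr mulnC.
Qed.

Lemma dhomog_mderivm d mm f :
  f \is d.-homog -> mderivm mm f \is (d - mdeg mm).-homog.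
Proof.
move=> fH; apply/dhomogP => m'; rewrite mcoeff_msupp mcoeff_mderivm => nz.
have : f@_(m' + mm) != 0 by apply: contraNneq nz; rewrite addmC => ->; rewrite mul0rn.
by rewrite -mcoeff_msupp => /(dhomog_mf fH) /=; rewrite mdegD => <-; lia.
Qed.

End DirectionalDerivative.

(** * Characteristic zero: orders of vanishing and division by a linear form *)

Section CharZero.
Variables (K : fieldType) (hK : [pchar K] =i pred0).

Lemma natr_eq0_char0 k : ((k%:R : K) == 0) = (k == 0%N).
Proof. by move/pcharf0P: hK => ->. Qed.

(* For homogeneous [f], [D_p^k f] and the partial derivatives of order
   [d - k] at [p] are, up to factorials, the same polarised form. *)
Lemma vanishes_dder n d (f : {mpoly K[n.+1]}) p mu : f \is d.-homog ->
  (mu <= d)%N -> vanishes_to_order f p mu <-> dder p (d.+1 - mu) f = 0.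
Proof.
move=> fH le_mu_d; split => [van|f0 mm lt_mm]; last first.
  (* Evaluate at [p]: by Euler's formula the result is the value of [mderivm mm f] times a falling
     factorial, nonzero since the degree [d - mdeg mm] is at least [d.+1 - mu]. *)
  have Qh := dhomog_mderivm mm fH.
  have := dder_meval p (d.+1 - mu) Qh; rewrite -mderivm_dder f0 linear0 meval0.
  move/esym/eqP; rewrite mulf_eq0 natr_eq0_char0 => /orP[|/eqP //].
  by rewrite -leqn0 leqNgt ffact_gt0; lia.
case: mu le_mu_d van => [|mu] le_mu_d van; first exact: (dder_gt_deg _ fH).
rewrite subSS; apply/mpolyP => mm; rewrite mcoeff0.
have fkH := dhomog_dder p (d - mu) fH.
have [mm_mu|] := eqVneq (mdeg mm) mu; last first.
  by move=> ne; rewrite (dhomog_nemf_coeff fkH) //= subKn // ltnW.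
(* The form [dder p (d - mu) f] has degree [mu], so for [mdeg mm = mu] its coefficient at [mm] is,
   up to factorials, the constant [mderivm mm] of it, which Euler's formula computes from
   [mderivm mm f] at [p]. *)
have QH : mderivm mm (dder p (d - mu) f) \is 0.-homog.
  by have := dhomog_mderivm mm fkH; rewrite (_ : (_ - mdeg mm = 0)%N) //; lia.
have Q0 : (mderivm mm (dder p (d - mu) f)).@[p] = 0.
  rewrite mderivm_dder (dder_meval _ _ (dhomog_mderivm mm fH)) van ?mulr0 //.
  by lia.
have : (mderivm mm (dder p (d - mu) f))@_0 = 0.
  move: Q0; rewrite {1}[mderivm _ _]mpolyE raddf_sum /= => <-.
  have [/eqP z|nz] := boolP (mderivm mm (dder p (d - mu) f) == 0).
    by rewrite z mcoeff0 msupp0 big_nil.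
  have suppE : msupp (mderivm mm (dder p (d - mu) f)) =i [:: 0%MM].
    move=> m'; rewrite inE; apply/idP/eqP => [/(dhomog_mf QH)/eqP|->].
      by rewrite mdeg_eq0 => /eqP.
    case E : (msupp _) => [|m1 t]; first by rewrite -msupp_eq0 E in nz.
    have : m1 \in msupp (mderivm mm (dder p (d - mu) f)) by rewrite E mem_head.
    by move/(dhomog_mf QH)/eqP; rewrite mdeg_eq0 => /eqP ->; rewrite mem_head.
  rewrite (perm_big [:: 0%MM]) /=.
    by rewrite big_seq1 mevalZ mevalX big1 ?mulr1 // => i _; rewrite mnm0E expr0.
  by apply: uniq_perm => //; apply: msupp_uniq.
rewrite mcoeff_mderivm addm0 => /eqP; rewrite -mulr_natr mulf_eq0.
rewrite natr_eq0_char0 => /orP[/eqP //|].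
rewrite -leqn0 leqNgt prodn_gt0 // => i.
by rewrite ffact_gt0 leqnn.
Qed.

(** Descending induction from a power exceeding the degree of [g]: once [D^(a + t + 1) g = 0],
    [dder_mulE] leaves [c (a + t + 1) D^(a + t) g = 0], and the scalar is invertible. *)
Lemma dder_mul_inv n d (p : 'I_n -> K) (h g : {mpoly K[n]}) c a :
  ddir p h = c%:MP -> c != 0 -> g \is d.-homog ->
  dder p a.+1 (h * g) = 0 -> dder p a g = 0.
Proof.
move=> hc c0 gH hg0.
have: dder p (a + d.+1) g = 0 by apply: dder_gt_deg gH _; lia.
elim: (d.+1) => [|t IHt]; first by rewrite addn0.
rewrite addnS => g0; apply: IHt.
have := dder_mulE g (a + t) hc; rewrite g0 mulr0 add0r.
rewrite (@dder_eq0_leq _ _ _ a.+1) ?ltnS ?leq_addr // => /esym/eqP.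
rewrite scaler_eq0 -mulr_natr mulf_eq0 (negPf c0) natr_eq0_char0 /=.
by move/eqP.
Qed.

End CharZero.

(** * Fat point systems *)

(** With [b] larger than the degree the condition at [x] is void, so updating deletes the point [x]
    without changing the index set. *)
Definition upd (I : eqType) T (a : I -> T) x b := fun i => if i == x then b else a i.

Lemma upd_eq (I : eqType) T (a : I -> T) x b : upd a x b x = b.
Proof. by rewrite /upd eqxx. Qed.

Lemma upd_neq (I : eqType) T (a : I -> T) x b i : i != x -> upd a x b i = a i.
Proof. by rewrite /upd => /negPf ->. Qed.

(** * Restriction to the hyperplane where the last coordinate vanishes *)

Section Restriction.
Variables (K : fieldType) (n : nat).
Implicit Types (f : {mpoly K[n.+1]}) (m : 'X_{1..n.+1}).

Let wid (j : 'I_n) : 'I_n.+1 := widen_ord (leqnSn n) j.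

Definition res_var (i : 'I_n.+1) : {mpoly K[n]} :=
  if insub (i : nat) is Some j then 'X_j else 0.

Definition mres f : {mpoly K[n]} := f \mPo [tuple res_var i | i < n.+1].

Lemma mres_is_linear : linear mres.
Proof. by move=> c f g; rewrite /mres comp_mpolyD comp_mpolyZ. Qed.

HB.instance Definition _ :=
  GRing.isLinear.Build K {mpoly K[n.+1]} {mpoly K[n]} _ mres mres_is_linear.

Definition mnm_res m : 'X_{1..n} := [multinom m (wid j) | j < n].

Lemma res_var_wid j : res_var (wid j) = 'X_j.
Proof. by rewrite /res_var /= valK. Qed.

Lemma res_var_max : res_var ord_max = 0.
Proof. by rewrite /res_var insubF //= ltnn. Qed.

Lemma mresX m :
  mres 'X_[m] = if m ord_max == 0%N then 'X_[mnm_res m] else 0.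
Proof.
rewrite /mres comp_mpolyX big_ord_recr /= tnth_mktuple res_var_max.
case: eqP => [->|/eqP m0]; last by rewrite expr0n (negPf m0) mulr0.
rewrite expr0 mulr1 mpolyXE_id; apply: eq_bigr => j _.
by rewrite tnth_mktuple res_var_wid mnmE.
Qed.

Lemma mdeg_mnm_res m : m ord_max = 0%N -> mdeg (mnm_res m) = mdeg m.
Proof.
move=> m0; rewrite !mdegE big_ord_recr /= m0 addn0.
by apply: eq_bigr => j _; rewrite mnmE.
Qed.

Lemma mnm_res_inj m1 m2 : m1 ord_max = 0%N -> m2 ord_max = 0%N ->
  mnm_res m1 = mnm_res m2 -> m1 = m2.
Proof.
move=> m10 m20 /mnmP E; apply/mnmP => i.
case: (unliftP ord_max i) => [j|] ->; last by rewrite m10 m20.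
have := E j; rewrite !mnmE; congr (m1 _ = m2 _); apply: val_inj => /=;
by rewrite /bump leqNgt ltn_ord.
Qed.

Lemma mresE f :
  mres f = \sum_(m <- msupp f) f@_m *: (if m ord_max == 0%N then 'X_[mnm_res m] else 0).
Proof.
rewrite {1}[f]mpolyE raddf_sum; apply: eq_bigr => m _ /=.
by rewrite linearZ /= mresX.
Qed.

Lemma dhomog_mres d f : f \is d.-homog -> mres f \is d.-homog.
Proof.
move=> fH; rewrite mresE big_seq rpred_sum // => m mf; rewrite rpredZ //.
case: eqP => [m0|_]; last exact: rpred0.
by rewrite dhomogX /= mdeg_mnm_res // (dhomog_mf fH mf).
Qed.

Lemma mderiv_mres j f : (mres f)^`M(j) = mres (f^`M(wid j)).
Proof.
rewrite mresE [LHS]linear_sum [in RHS]/mderiv [RHS]linear_sum /=.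
apply: eq_bigr => m _; rewrite [LHS]linearZ [RHS]linearZ /=.
rewrite mulrC -scalerA; congr (_ *: _); rewrite mresX.
have maxE : (m - U_(wid j))%MM ord_max = m ord_max.
  rewrite mnmBE mnm1E -val_eqE /= ltn_eqF ?subn0 //.
rewrite maxE; case: eqP => _; last by rewrite raddf0 scaler0.
rewrite mderivX mnmE; congr (_ *: 'X_[_]); apply/mnmP => k.
by rewrite !mnmE -!val_eqE.
Qed.

Lemma ddir_mres (p : 'I_n.+1 -> K) f : p ord_max = 0 ->
  mres (ddir p f) = ddir (fun j => p (wid j)) (mres f).
Proof.
move=> p0; rewrite /ddir big_ord_recr /= p0 scale0r addr0 raddf_sum.
by apply: eq_bigr => j _ /=; rewrite linearZ /= mderiv_mres.
Qed.

Lemma dder_mres (p : 'I_n.+1 -> K) k f : p ord_max = 0 ->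
  mres (dder p k f) = dder (fun j => p (wid j)) k (mres f).
Proof. by move=> p0; elim: k => // k IHk; rewrite !dderSr ddir_mres // IHk. Qed.

Lemma mres_meval f (v : 'I_n.+1 -> K) : v ord_max = 0 ->
  (mres f).@[fun j => v (wid j)] = f.@[v].
Proof.
move=> v0; rewrite /mres comp_mpoly_meval; apply: meval_eq => i.
rewrite tnth_mktuple; case: (unliftP ord_max i) => [j|] ->; last first.
  by rewrite res_var_max meval0 v0.
have -> : lift ord_max j = wid j by apply: val_inj => /=; rewrite /bump leqNgt ltn_ord.
by rewrite res_var_wid mevalXU.
Qed.

(** Distinct monomials free of the last variable have distinct restrictions, so nothing cancels:
    every monomial of [f] must contain that variable. *)
Lemma mres_eq0 d f : f \is d.-homog -> mres f = 0 ->
  exists2 g, g \is d.-1.-homog & f = 'X_ord_max * g.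
Proof.
move=> fH f0.
have supp m : m \in msupp f -> m ord_max != 0%N.
  move=> mf; apply/eqP => m0; have := congr1 (mcoeff (mnm_res m)) f0.
  rewrite mcoeff0 mresE raddf_sum (bigD1_seq m) //= m0 eqxx mcoeffZ mcoeffX.
  rewrite eqxx mulr1 big1_seq ?addr0 => [/eqP|m1 /andP[ne m1f]].
    by rewrite -[_ == 0]negbK -mcoeff_msupp mf.
  rewrite mcoeffZ; case: eqP => [m10|_]; last by rewrite mcoeff0 mulr0.
  rewrite mcoeffX; case: eqP => [/mnm_res_inj E|_]; last by rewrite mulr0.
  by rewrite E ?eqxx in ne.
exists (\sum_(m <- msupp f) f@_m *: 'X_[m - U_(ord_max)]).
  rewrite big_seq rpred_sum // => m mf; rewrite rpredZ // dhomogX /=.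
  have le1 : (U_(ord_max) <= m)%MM by rewrite lep1mP supp.
  by rewrite -(dhomog_mf fH mf) /= -{2}(submK le1) mdegD mdeg1 addn1.
rewrite {1}[f]mpolyE mulr_sumr; apply: eq_big_seq => m mf.
by rewrite -scalerAr -mpolyXD addmC submK // lep1mP supp.
Qed.

End Restriction.

(** * Systems as vector spaces and inequalities between their dimensions *)

Section System.
Variables (K : fieldType) (s : nat).

(** Defined for arbitrary [phi]; it agrees with [phi] only when [phi] is linear and sends forms of
    degree [d] to forms of degree [e], which is what [hliftE] asks. *)
Definition hlift n n' d e (phi : {mpoly K[n.+1]} -> {mpoly K[n'.+1]}) :
    'Hom(dhomog n.+1 K d, dhomog n'.+1 K e) :=
  linfun (fun f : dhomog n.+1 K d => @indhomog n'.+1 K e (phi (val f))).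

Lemma hliftE n n' d e (phi : {mpoly K[n.+1]} -> {mpoly K[n'.+1]}) f :
  linear phi -> (forall g, g \is d.-homog -> phi g \is e.-homog) ->
  val (hlift d e phi f) = phi (val f).
Proof.
move=> lin_phi hom_phi.
pose g (f : dhomog n.+1 K d) := @indhomog n'.+1 K e (phi (val f)).
have gE h : val (g h) = phi (val h).
  by rewrite /g /indhomog insubdK // hom_phi // dhomog_is_dhomog.
have lin_g : linear g.
  by move=> c h1 h2; apply: val_inj; rewrite gE !linearP /= lin_phi !gE.
pose G : {linear dhomog n.+1 K d -> dhomog n'.+1 K e} :=
  HB.pack g (GRing.isLinear.Build _ _ _ _ g lin_g).
by rewrite /hlift (lfunE G) /= gE.
Qed.

(** The space [V(d; a)]. If [a i > d] the truncated target degree is 0, harmlessly, since the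
    derivative is then zero. *)
Definition fatsys n (p : 'I_s -> 'I_n.+1 -> K) d (a : 'I_s -> nat) :
    {vspace dhomog n.+1 K d} :=
  (\bigcap_(i < s) lker (hlift d (d - a i) (dder (p i) (a i))))%VS.

Lemma fatsysP n (p : 'I_s -> 'I_n.+1 -> K) d a f :
  reflect (forall i, dder (p i) (a i) (val f) = 0) (f \in fatsys p d a).
Proof.
rewrite memvE; apply: (iffP subv_bigcapP) => [H i|H i _].
  have := H i isT; rewrite -memvE memv_ker => /eqP/(congr1 val).
  by rewrite hliftE //; [exact: linearP | move=> g; exact: dhomog_dder].
rewrite -memvE memv_ker; apply/eqP/val_inj; rewrite hliftE ?H //.
  exact: linearP.
by move=> g; exact: dhomog_dder.
Qed.

Lemma fatsys_neq0 n (p : 'I_s -> 'I_n.+1 -> K) d a (f : {mpoly K[n.+1]}) :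
  f \is d.-homog -> f != 0 -> (forall i, dder (p i) (a i) f = 0) ->
  (0 < \dim (fatsys p d a))%N.
Proof.
move=> fH f0 fa; rewrite lt0n dimv_eq0; apply: contraNneq f0 => V0.
have : DHomog fH \in fatsys p d a by apply/fatsysP.
by rewrite V0 memv0 => /eqP/(congr1 val) /= ->.
Qed.

Lemma fatsys_pick n (p : 'I_s -> 'I_n.+1 -> K) d a :
  (0 < \dim (fatsys p d a))%N ->
  exists f : {mpoly K[n.+1]}, [/\ f \is d.-homog, f != 0 &
    forall i, dder (p i) (a i) f = 0].
Proof.
rewrite lt0n dimv_eq0 -vpick0 => f0.
have /fatsysP fV := memv_pick (fatsys p d a).
exists (val (vpick (fatsys p d a))); split=> //.
exact: dhomog_is_dhomog.
Qed.

Lemma fatsys_exp0 n (p : 'I_s -> 'I_n.+1 -> K) d a i :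
  a i = 0%N -> \dim (fatsys p d a) = 0%N.
Proof.
move=> a0; apply/eqP; rewrite dimv_eq0; apply/eqP/vspaceP => f.
rewrite memv0; apply/idP/eqP => [/fatsysP/(_ i)|->]; last exact: mem0v.
by rewrite a0 => f0; apply: val_inj.
Qed.

(* The derivative [D^(a x)] at the point [x] has kernel the smaller system
   and image inside the system of degree [d - a x]. *)
Lemma fatsys_drop_le n (p : 'I_s -> 'I_n.+1 -> K) d a x b : (d < b)%N ->
  (\dim (fatsys p d (upd a x b)) <=
   \dim (fatsys p d a) + \dim (fatsys p (d - a x) (upd a x b)))%N.
Proof.
move=> lt_db; set U := fatsys p d _.
pose L : 'Hom(_, _) := hlift d (d - a x) (dder (p x) (a x)).
have LE f : val (L f) = dder (p x) (a x) (val f).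
  by apply: hliftE; [exact: linearP | move=> g; exact: dhomog_dder].
rewrite -(limg_ker_dim L U) leq_add //; apply: dimvS; apply/subvP => f.
  rewrite memv_cap => /andP[/fatsysP fU fL]; apply/fatsysP => i.
  have [->|ne] := eqVneq i x; last by have := fU i; rewrite upd_neq.
  by move: fL; rewrite memv_ker => /eqP/(congr1 val); rewrite LE.
case/memv_imgP => g /fatsysP gU ->; apply/fatsysP => i; rewrite LE.
by rewrite dder_comm gU linear0.
Qed.

(** Let [W], [W'] be the systems in degrees [d.+1] and [d], and [U], [U'] the same without [x]. Then
    [h U'] lies in [U], and [W] meets [h U'] inside [h W'] because [h] does not vanish at [p x]. The
    dimension formula for [W + h U'] gives the bound. *)
Lemma fatsys_mul_le (hK : [pchar K] =i pred0) n (p : 'I_s -> 'I_n.+1 -> K) d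
    a a' x b h c :
  h \is 1.-homog -> ddir (p x) h = c%:MP -> c != 0 -> a x = (a' x).+1 ->
  (d.+1 < b)%N ->
  (forall i, i != x -> (ddir (p i) h = 0 /\ a' i = a i) \/ a i = (a' i).+1) ->
  (\dim (fatsys p d.+1 a) + \dim (fatsys p d (upd a' x b)) <=
   \dim (fatsys p d.+1 (upd a x b)) + \dim (fatsys p d a'))%N.
Proof.
move=> hH hc c0 ax lt_db ha.
have h0 : h != 0.
  apply: contraNneq c0 => h0; move: hc; rewrite h0 linear0 => /eqP.
  by rewrite eq_sym mpolyC_eq0.
pose L : 'Hom(_, _) := hlift d d.+1 (fun f : {mpoly K[n.+1]} => h * f).
have LE f : val (L f) = h * val f.
  apply: hliftE => [k f1 f2|g gH]; first by rewrite mulrDr scalerAr.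
  exact: (dhomogM hH gH).
have Linj : lker L == 0%VS.
  apply/lker0P => f1 f2 /(congr1 val); rewrite !LE => /(mulfI h0).
  exact: val_inj.
set U' := fatsys p d (upd a' x b); set U := fatsys p d.+1 (upd a x b).
set W := fatsys p d.+1 a; set W' := fatsys p d a'.
have dimL X : \dim (L @: X)%VS = \dim X.
  by apply: limg_dim_eq; move/eqP: Linj => ->; rewrite capv0.
have sWU : (W <= U)%VS.
  apply/subvP => f /fatsysP fW; apply/fatsysP => i; rewrite /upd.
  by case: eqP => // ->; apply: dder_gt_deg lt_db; apply: dhomog_is_dhomog.
have sLU : (L @: U' <= U)%VS.
  apply/subvP => f /memv_imgP[g /fatsysP gU' ->]; apply/fatsysP => i; rewrite LE.
  have [->|ne] := eqVneq i x.
    rewrite upd_eq; apply: dder_gt_deg lt_db.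
    exact: (dhomogM hH (dhomog_is_dhomog g)).
  have := gU' i; rewrite !upd_neq // => gi.
  have [[hi ai]|ai] := ha i ne.
    (* The factor [h] has exponent 1 at a point where it vanishes, and exponent 2 at any point. *)
    have -> : a i = (1 + a' i).-1 by rewrite ai.
    exact: dder_mul0.
  have -> : a i = (2 + a' i).-1 by rewrite ai.
  by apply: dder_mul0 => //; apply: dder_gt_deg hH _.
have sWLW' : (W :&: L @: U' <= L @: W')%VS.
  apply/subvP => f; rewrite memv_cap => /andP[/fatsysP fW /memv_imgP[g gU' fE]].
  rewrite fE memv_img //; apply/fatsysP => i.
  have [->|ne] := eqVneq i x.
    apply: (dder_mul_inv hK hc c0 (dhomog_is_dhomog g)).
    by rewrite -LE -fE -ax.
  by have /fatsysP/(_ i) := gU'; rewrite upd_neq.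
rewrite -(dimL U') -(dimL W') -dimv_sum_cap leq_add ?dimvS //.
by rewrite subv_add sWU.
Qed.

End System.

(** * General configurations *)

Lemma eq_dder (K : fieldType) n (p q : 'I_n -> K) k f :
  p =1 q -> dder p k f = dder q k f.
Proof.
move=> E; elim: k => // k IHk; rewrite !dderSr IHk.
by apply: eq_bigr => j _; rewrite E.
Qed.

Lemma ddirX (K : fieldType) n (p : 'I_n -> K) i : ddir p 'X_i = (p i)%:MP.
Proof.
have UU : (U_(i) - U_(i) = 0)%MM by apply/mnmP => j; rewrite !mnmE subnn.
rewrite /ddir (bigD1 i) //= big1 => [|j ne].
  by rewrite mderivX mnm1E eqxx scale1r UU mpolyX0 addr0 -mul_mpolyC mulr1.
by rewrite mderivX mnm1E eq_sym (negPf ne) scale0r scaler0.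
Qed.

Lemma dder_mulc (K : fieldType) n (p : 'I_n -> K) k h g : ddir p h = 0 ->
  dder p k (h * g) = h * dder p k g.
Proof.
by move=> h0; elim: k => // k IHk; rewrite !dderSr IHk ddirM h0 mul0r add0r.
Qed.

Lemma mpolyX_neq0 (K : fieldType) n (m : 'X_{1..n}) : 'X_[m] != 0 :> {mpoly K[n]}.
Proof. by rewrite -msupp_eq0 msuppX. Qed.

Definition lform (K : fieldType) n (c : 'I_n -> K) : {mpoly K[n]} :=
  \sum_j c j *: 'X_j.

Lemma lform_homog (K : fieldType) n (c : 'I_n -> K) : lform c \is 1.-homog.
Proof. by rewrite rpred_sum // => j _; rewrite rpredZ // dhomogX /= mdeg1. Qed.

Lemma ddir_lform (K : fieldType) n (p c : 'I_n -> K) :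
  ddir p (lform c) = (\sum_j c j * p j)%:MP.
Proof.
rewrite raddf_sum raddf_sum /=; apply: eq_bigr => j _.
by rewrite linearZ /= ddirX -mul_mpolyC mpolyCM.
Qed.

Lemma lform_neq0 (K : fieldType) n (c : 'I_n -> K) j : c j != 0 -> lform c != 0.
Proof.
apply: contraNneq => /(congr1 (mcoeff U_(j))).
rewrite mcoeff0 raddf_sum (bigD1 j) //= mcoeffZ mcoeffX eqxx mulr1 big1 ?addr0.
  by move=> ->.
move=> k ne; rewrite mcoeffZ mcoeffX; case: eqP => [E|_]; last by rewrite mulr0.
have /mnmP/(_ k) := E; rewrite !mnm1E eqxx eq_sym (negPf ne).
by [].
Qed.

(** * Points where polynomials do not vanish *)

Section NonVanishing.
Variables (K : fieldType) (hK : [pchar K] =i pred0).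

(** In characteristic zero the integers below [size P] are distinct elements of [K], too many to be
    all roots. *)
Lemma poly_nonroot (P : {poly K}) : P != 0 -> exists t, P.[t] != 0.
Proof.
move=> P0; pose rs : seq K := [seq i%:R | i <- iota 0 (size P)].
have [/allP H|] := boolP (all (root P) rs); last first.
  by case/allPn => t _ Pt; exists t.
have := max_poly_roots P0 (introT allP H); rewrite map_inj_in_uniq ?iota_uniq.
  by rewrite size_map size_iota ltnn => /(_ isT).
move=> i j _ _; wlog le_ij : i j / (i <= j)%N.
  by move=> W; case/orP: (leq_total i j) => /W // H1 /esym/H1.
move/eqP; rewrite eq_sym -subr_eq0 -natrB // natr_eq0_char0 // subn_eq0.
by move=> le_ji; apply/eqP; rewrite eqn_leq le_ij.
Qed.

(* Restrict both polynomials to the line joining the two points. *)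
Lemma nonvanish_mul n (G1 G2 : {mpoly K[n]}) v1 v2 :
  G1.@[v1] != 0 -> G2.@[v2] != 0 -> exists v, (G1 * G2).@[v] != 0.
Proof.
move=> H1 H2; pose h k : {poly K} := (v1 k)%:P + 'X * (v2 k - v1 k)%:P.
have lineE G t : (mmap polyC h G).[t] = G.@[fun k => v1 k + t * (v2 k - v1 k)].
  rewrite mevalE /mmap horner_sum; apply: eq_bigr => m _.
  rewrite hornerM hornerC /mmap1 horner_prod; congr (_ * _).
  by apply: eq_bigr => k _; rewrite horner_exp !hornerE.
have nz G : (exists t, (mmap polyC h G).[t] != 0) -> mmap polyC h G != 0.
  by case=> t; apply: contraNneq => ->; rewrite horner0.
have [t Ht] : exists t, (mmap polyC h G1 * mmap polyC h G2).[t] != 0.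
  apply: poly_nonroot; rewrite mulf_neq0 //; apply: nz; [exists 0|exists 1].
    by rewrite lineE (meval_eq _ (v2 := v1)) // => k; rewrite mul0r addr0.
  by rewrite lineE (meval_eq _ (v2 := v2)) // => k; rewrite mul1r addrC subrK.
exists (fun k => v1 k + t * (v2 k - v1 k)).
by rewrite mevalM -!lineE -hornerM.
Qed.

(** Induction on the variables and the degree: a nonzero restriction to the last coordinate
    hyperplane supplies a point; otherwise that coordinate divides [f] and [nonvanish_mul]
    applies. *)
Lemma homog_nonroot n d (f : {mpoly K[n]}) : f \is d.-homog -> f != 0 ->
  exists v, f.@[v] != 0.
Proof.
elim: n d f => [|n IHn] d f.
  move=> _ f0; exists (fun=> 0); move: f0; rewrite (nvar0_mpolyC f) mevalC.
  by rewrite mpolyC_eq0.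
elim: d f => [|d IHd] f fH f0.
all: have [r0|r0] := eqVneq (mres f) 0; last first.
1,3: have [v Hv] := IHn _ _ (dhomog_mres fH) r0.
1,2: pose w (i : 'I_n.+1) := if insub (i : nat) is Some j then v j else 0.
1,2: exists w; rewrite -mres_meval /w ?insubF ?ltnn //;
     by rewrite (meval_eq _ (v2 := v)) // => j /=; rewrite valK.
all: have [g gH fE] := mres_eq0 fH r0.
  (* In degree 0 the quotient [g] also has degree 0, so [f] would be a form of degree 1 as well. *)
  have : f \is 1.-homog.
    by rewrite fE; apply: (@dhomogM _ _ _ 1 _ 0) => //; rewrite dhomogX /= mdeg1.
  by move/(dhomog_uniq f0 fH).
have [|v Hv] := IHd g gH; first by apply: contraNneq f0 => g0; rewrite fE g0 mulr0.
rewrite fE; apply: (@nonvanish_mul _ _ _ (fun=> 1) v) => //.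
by rewrite mevalXU oner_neq0.
Qed.

End NonVanishing.

(** * Open conditions on configurations and semicontinuity *)

Section Generic.
Variables (K : fieldType) (hK : [pchar K] =i pred0) (s : nat).

(** Nonemptiness of the open set is recorded by a point where [G] is nonzero instead of by [G != 0];
    this is the form that [nonvanish_mul] handles. *)
Definition generic n (Q : ('I_s -> 'I_n.+1 -> K) -> Prop) :=
  exists G : {mpoly K[s * n.+1]},
    (exists v, G.@[v] != 0) /\ forall v, G.@[v] != 0 -> Q (@pts_of K n s v).

Definition vec_of n (p : 'I_s -> 'I_n.+1 -> K) : 'I_(s * n.+1) -> K :=
  fun k => mxvec (\matrix_(i, j) p i j) 0 k.

Lemma pts_vec_of n (p : 'I_s -> 'I_n.+1 -> K) i j : pts_of (vec_of p) i j = p i j.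
Proof. by rewrite /pts_of /vec_of mxvecE mxE. Qed.

Lemma generic_and n Q1 Q2 : @generic n Q1 -> generic Q2 ->
  generic (fun p => Q1 p /\ Q2 p).
Proof.
move=> [G1 [[v1 H1] Q1G]] [G2 [[v2 H2] Q2G]]; exists (G1 * G2); split.
  exact: (nonvanish_mul hK H1 H2).
by move=> v; rewrite mevalM mulf_eq0 negb_or => /andP[/Q1G ? /Q2G ?].
Qed.

Lemma generic_imp n (Q1 Q2 : _ -> Prop) : (forall p, Q1 p -> Q2 p) ->
  @generic n Q1 -> generic Q2.
Proof. by move=> Q12 [G [Gv GQ]]; exists G; split=> // v /GQ/Q12. Qed.

Lemma generic_true n (Q : _ -> Prop) : (forall p, Q p) -> @generic n Q.
Proof.
by move=> HQ; exists 1; split=> //; exists (fun=> 0); rewrite meval1 oner_neq0.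
Qed.

Lemma generic_ex n Q : @generic n Q -> exists p, Q p.
Proof. by case=> G [[v Gv] GQ]; exists (pts_of v); apply: GQ. Qed.

Lemma generic_all n k (Q : nat -> _ -> Prop) :
  (forall t, (t < k)%N -> @generic n (Q t)) ->
  generic (fun p => forall t, (t < k)%N -> Q t p).
Proof.
elim: k => [|k IHk] HQ; first by apply: generic_true.
have := generic_and (IHk (fun t lt_tk => HQ t (ltnW lt_tk))) (HQ k (ltnSn k)).
apply: generic_imp => p [H1 H2] t; rewrite ltnS leq_eqVlt.
by case/predU1P => [->|/H1].
Qed.

Lemma eq_fatsys n (p q : 'I_s -> 'I_n.+1 -> K) d a :
  (forall i j, p i j = q i j) -> fatsys p d a = fatsys q d a.
Proof.
move=> E; apply/vspaceP => f; apply/fatsysP/fatsysP => H i;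
by rewrite -(H i); apply: eq_dder => j; rewrite E.
Qed.

Lemma coef_dder_mpoly n i k (f : {mpoly K[n.+1]}) beta :
  exists E : {mpoly K[s * n.+1]},
    forall v, E.@[v] = (dder (@pts_of K n s v i) k f)@_beta.
Proof.
elim: k beta => [|k IHk] beta.
  by exists (f@_beta)%:MP => v; rewrite mevalC.
have /fin_all_exists[E HE] : forall j : 'I_n.+1, exists E : {mpoly K[s * n.+1]},
    forall v, E.@[v] = (dder (@pts_of K n s v i) k f)@_(beta + U_(j)).
  by move=> j; apply: IHk.
exists (\sum_j 'X_(mxvec_index i j) * (E j *+ (beta j).+1)) => v.
rewrite dderSr !raddf_sum; apply: eq_bigr => j _ /=.
by rewrite mevalM mevalXU mevalMn HE mcoeffZ mcoeff_mderiv.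
Qed.

(** Fix a complement [U] of the system at [p0]. Meeting [U] only in 0 is a full rank condition on a
    matrix polynomial in the points; it holds at [p0], hence on an open set, where the dimension is
    at most the codimension of [U]. *)
Lemma fatsys_semicontinuous n d a (p0 : 'I_s -> 'I_n.+1 -> K) :
  @generic n (fun p => (\dim (fatsys p d a) <= \dim (fatsys p0 d a))%N).
Proof.
(* The conditions are indexed by a point and a monomial: the coefficients of all the forms
   [dder (p i) (a i) f]. *)
pose J : finType := ('I_s * 'X_{1..n.+1 < d.+1})%type.
pose U := ((fatsys p0 d a)^C)%VS; pose r := \dim U; pose e := vbasis U.
have /fin_all_exists[E HE] : forall kc : 'I_r * 'I_#|J|,
    exists E : {mpoly K[s * n.+1]}, forall v, E.@[v] =
      (dder (@pts_of K n s v (enum_val kc.2).1) (a (enum_val kc.2).1)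
        (val e`_kc.1))@_(enum_val kc.2).2.
  by move=> kc; apply: coef_dder_mpoly.
pose ME : 'M[{mpoly K[s * n.+1]}]_(r, #|J|) := \matrix_(k, c) E (k, c).
pose M v : 'M[K]_(r, #|J|) := map_mx (meval v) ME.
have capM v : (U :&: fatsys (@pts_of K n s v) d a = 0)%VS <-> row_free (M v).
  have rowM (x : 'rV_r) : x *m M v = 0 <->
      \sum_k x 0 k *: e`_k \in fatsys (@pts_of K n s v) d a.
    have coefE i beta : (dder (@pts_of K n s v i) (a i)
        (val (\sum_k x 0 k *: e`_k)))@_beta =
        \sum_k x 0 k * (dder (@pts_of K n s v i) (a i) (val e`_k))@_beta.
      rewrite !raddf_sum; apply: eq_bigr => k _ /=.
      by rewrite -mcoeffZ -dderZ.
    split=> [xM|/fatsysP H].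
      apply/fatsysP => i; apply/mpolyP => beta; rewrite mcoeff0.
      have [lt_b|ge_b] := ltnP (mdeg beta) d.+1; last first.
        set f := val _; have fH : f \is d.-homog by apply: dhomog_is_dhomog.
        by rewrite (dhomog_nemf_coeff (dhomog_dder _ _ fH)) //=; lia.
      rewrite coefE; have /rowP/(_ (enum_rank ((i, BMultinom lt_b) : J))) := xM.
      rewrite !mxE => xM0; rewrite -[RHS]xM0; apply: eq_bigr => k _.
      by rewrite !mxE HE /= enum_rankK.
    apply/rowP => c; rewrite !mxE; have := H (enum_val c).1.
    move/(congr1 (mcoeff (enum_val c).2)); rewrite coefE mcoeff0 => H0.
    by rewrite -[RHS]H0; apply: eq_bigr => k _; rewrite !mxE HE.
  split=> [UV0|freeM].
    apply: inj_row_free => x /rowM xV; apply/rowP => k; rewrite mxE.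
    have : \sum_k x 0 k *: e`_k \in (U :&: fatsys (@pts_of K n s v) d a)%VS.
      rewrite memv_cap xV andbT rpred_sum // => l _; rewrite rpredZ //.
      by rewrite vbasis_mem // mem_nth // size_tuple.
    rewrite UV0 memv0 => /eqP.
    by have /freeP H := basis_free (vbasisP U) => /H.
  apply/eqP; rewrite -subv0; apply/subvP => u; rewrite memv_cap memv0.
  case/andP => uU uV; have uE := coord_vbasis uU.
  pose x : 'rV_r := \row_k coord e k u.
  have uEx : u = \sum_k x 0 k *: e`_k.
    by rewrite {1}uE; apply: eq_bigr => k _; rewrite mxE.
  have x0 : x = 0.
    by apply: (row_free_inj freeM); rewrite mul0mx; apply/rowM; rewrite -uEx.
  by rewrite uEx x0 big1 // => k _; rewrite mxE scale0r.
have : row_free (M (vec_of p0)).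
  apply/capM; rewrite (@eq_fatsys _ _ p0); last by move=> i j; rewrite pts_vec_of.
  by rewrite capvC capv_compl.
(* A right inverse [B] at [p0] replaces the choice of a nonzero maximal minor. *)
case/row_freeP => B MB; exists (\det (ME *m map_mx (@mpolyC _ K) B)).
have detE v : (\det (ME *m map_mx (@mpolyC _ K) B)).@[v] = \det (M v *m B).
  rewrite -det_map_mx map_mxM /=; congr (\det (_ *m _)).
  by apply/matrixP => i j; rewrite !mxE mevalC.
split; first by exists (vec_of p0); rewrite detE MB det1 oner_neq0.
move=> v; rewrite detE -unitfE -unitmxE => MBu.
have /capM UV0 : row_free (M v).
  apply/row_freeP; exists (B *m invmx (M v *m B)).
  by rewrite mulmxA mulmxV.
have := dimvS (subvf (U + fatsys (@pts_of K n s v) d a)%VS).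
rewrite dimv_disjoint_sum // /U dimv_compl.
have := dimvS (subvf (fatsys p0 d a)); lia.
Qed.

(** At most [n.+1] general points are linearly independent, so a linear form takes prescribed values
    at them. *)
Lemma generic_hyperplane n (A : {set 'I_s}) x : (#|A| <= n)%N -> x \notin A ->
  @generic n (fun p => exists c : 'I_n.+1 -> K,
    (forall i, i \in A -> \sum_j c j * p i j = 0) /\ \sum_j c j * p x j = 1).
Proof.
move=> leA xA; pose B := x |: A; pose k := #|B|.
have le_k : (k <= n.+1)%N by rewrite /k cardsU1 xA.
pose io (y : 'I_k) : 'I_s := enum_val y.
pose ME : 'M[{mpoly K[s * n.+1]}]_(k, n.+1) := \matrix_(y, j) 'X_(mxvec_index (io y) j).
pose M v : 'M[K]_(k, n.+1) := \matrix_(y, j) @pts_of K n s v (io y) j.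
(* The test configuration places the points of [B] at distinct coordinate points. *)
pose p0 : 'I_s -> 'I_n.+1 -> K := fun i j => (index i (enum B) == j)%:R.
pose C : 'M[K]_(n.+1, k) := (M (vec_of p0))^T.
have MC : M (vec_of p0) *m C = 1%:M.
  apply/matrixP => y z; rewrite !mxE (bigD1 (widen_ord le_k y)) //= !mxE !pts_vec_of.
  have idx (w : 'I_k) : index (io w) (enum B) = w.
    rewrite /io /enum_val index_uniq ?enum_uniq //.
    by rewrite -cardE.
  rewrite /p0 !idx eqxx mul1r big1 ?addr0 => [|j ne].
    by rewrite eq_sym -val_eqE.
  rewrite !mxE !pts_vec_of /p0 idx; case: eqP => [E|_]; last by rewrite mul0r.
  by case/eqP: ne; apply: val_inj.
exists (\det (ME *m map_mx (@mpolyC _ K) C)).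
have detE v : (\det (ME *m map_mx (@mpolyC _ K) C)).@[v] = \det (M v *m C).
  rewrite -det_map_mx map_mxM /=; congr (\det (_ *m _)).
    by apply/matrixP => i j; rewrite !mxE mevalXU.
  by apply/matrixP => i j; rewrite !mxE mevalC.
split; first by exists (vec_of p0); rewrite detE MC det1 oner_neq0.
move=> v; rewrite detE -unitfE -unitmxE => MCu.
have xB : x \in B by rewrite setU11.
pose c : 'cV_n.+1 := C *m invmx (M v *m C) *m delta_mx (enum_rank_in xB x) 0.
have cE i : i \in B -> \sum_j c j 0 * pts_of v i j = (i == x)%:R.
  move=> iB; have : (M v *m c) (enum_rank_in xB i) 0 = (i == x)%:R.
    rewrite /c !mulmxA mulmxV // mul1mx mxE eqxx andbT.
    by rewrite -(inj_eq enum_val_inj) !enum_rankK_in.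
  rewrite mxE => <-; apply: eq_bigr => j _.
  by rewrite !mxE /io enum_rankK_in // mulrC.
exists (fun j => c j 0); split=> [i iA|]; rewrite cE ?eqxx //.
  by case: eqP => // E; rewrite -E iA in xA.
by rewrite /B inE iA orbT.
Qed.

End Generic.

(** * Degeneration to a line, nonempty systems *)

Section LineDegeneration.
Variables (K : fieldType) (hK : [pchar K] =i pred0) (s : nat).

Definition ext_pt n (q : 'I_n -> K) (c : K) (k : 'I_n.+1) : K :=
  if insub (k : nat) is Some k' then q k' else c.

Lemma ext_pt_wid n (q : 'I_n -> K) c j :
  ext_pt q c (widen_ord (leqnSn n) j) = q j.
Proof. by rewrite /ext_pt /= valK. Qed.

Lemma ext_pt_max n (q : 'I_n -> K) c : ext_pt q c ord_max = c.
Proof. by rewrite /ext_pt insubF //= ltnn. Qed.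

(* All points but [i], [j] on the last coordinate hyperplane, and the line
   through the points [i] and [j] meeting it at [p' j]. *)
Definition line_config n (p' : 'I_s -> 'I_n -> K) (i j l : 'I_s) : 'I_n.+1 -> K :=
  if l == i then ext_pt (fun=> 0) 1 else
  if l == j then ext_pt (p' j) 1 else ext_pt (p' l) 0.

(** For [b] above the degree, the trace on the hyperplane has one point [j] in place of [i] and [j].
    In the residual system only [i] and [j], being off the hyperplane, lose one from their
    exponents. *)
Definition trace_exp (a : 'I_s -> nat) i j b := upd (upd a j (a i + a j).-1) i b.
Definition resid_exp (a : 'I_s -> nat) i j := upd (upd a i (a i).-1) j (a j).-1.

(** Rank and nullity for restriction to the hyperplane: the image satisfies the trace conditions, by
    [dder_line0] at the new point, and the kernel is the last variable times the residual system. *)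
Lemma fatsys_line_le n (p' : 'I_s -> 'I_n.+1 -> K) d a i j b :
  i != j -> (0 < a i)%N -> (0 < a j)%N -> (d.+1 < b)%N ->
  (\dim (fatsys (line_config p' i j) d.+1 a) <=
   \dim (fatsys p' d.+1 (trace_exp a i j b)) +
   \dim (fatsys (line_config p' i j) d (resid_exp a i j)))%N.
Proof.
move=> ne_ij ai aj lt_b; set p := line_config p' i j.
set U := fatsys p _ a.
have pi : p i = ext_pt (fun=> 0) 1 by rewrite /p /line_config eqxx.
have pj : p j = ext_pt (p' j) 1.
  by rewrite /p /line_config eq_sym (negPf ne_ij) eqxx.
have pl l : l != i -> l != j -> p l = ext_pt (p' l) 0.
  by rewrite /p /line_config => /negPf -> /negPf ->.
pose L : 'Hom(_, _) := hlift d.+1 d.+1 (@mres K n.+1).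
have LE f : val (L f) = mres (val f).
  by apply: hliftE; [exact: linearP | move=> g; exact: dhomog_mres].
pose M : 'Hom(_, _) :=
  hlift d d.+1 (fun f : {mpoly K[n.+2]} => 'X_ord_max * f).
have XH : ('X_ord_max : {mpoly K[n.+2]}) \is 1.-homog by rewrite dhomogX /= mdeg1.
have ME f : val (M f) = 'X_ord_max * val f.
  apply: hliftE => [k f1 f2|g gH]; first by rewrite mulrDr scalerAr.
  exact: (dhomogM XH gH).
rewrite -(limg_ker_dim L U) addnC leq_add //.
  apply: dimvS; apply/subvP => _ /memv_imgP[f /fatsysP fU ->].
  apply/fatsysP => l; rewrite LE /trace_exp.
  have fH : mres (val f) \is d.+1.-homog.
    by apply: dhomog_mres; apply: dhomog_is_dhomog.
  have [->|li] := eqVneq l i; first by rewrite upd_eq; apply: dder_gt_deg fH _.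
  rewrite upd_neq //; have [->|lj] := eqVneq l j.
    (* The difference of the points [j] and [i] lies on the hyperplane and is [p' j] there. *)
    rewrite upd_eq; pose r := ext_pt (p' j) 0.
    have rE k : r k = p j k - p i k.
      rewrite pi pj /r /ext_pt; case: insub => [k'|]; first by rewrite subr0.
      by rewrite subrr.
    have := dder_line0 rE (fU i) (fU j) => /(congr1 (@mres K n.+1)).
    rewrite dder_mres; last exact: ext_pt_max.
    rewrite linear0 => r0; rewrite -[RHS]r0.
    by apply: eq_dder => k; rewrite /r ext_pt_wid.
  rewrite upd_neq //; have := fU l; rewrite pl // => /(congr1 (@mres K n.+1)).
  rewrite dder_mres; last exact: ext_pt_max.
  rewrite linear0 => r0; rewrite -[RHS]r0.
  by apply: eq_dder => k; rewrite ext_pt_wid.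
apply: (@leq_trans (\dim (M @: fatsys p d (resid_exp a i j)))); last first.
  by rewrite -[leqRHS](limg_ker_dim M) leq_addl.
apply: dimvS; apply/subvP => f; rewrite memv_cap => /andP[/fatsysP fU].
rewrite memv_ker => /eqP/(congr1 val); rewrite LE => f0.
have [g gH fE] := mres_eq0 (dhomog_is_dhomog f) f0.
have -> : f = M (DHomog gH) by apply: val_inj; rewrite ME -fE.
rewrite memv_img //; apply/fatsysP => l /=; rewrite /resid_exp.
have [->|lj] := eqVneq l j.
  rewrite upd_eq; apply: (dder_mul_inv hK (c := 1) (h := 'X_ord_max)) gH _.
  - by rewrite ddirX pj ext_pt_max.
  - exact: oner_neq0.
  - by rewrite prednK // -fE.
rewrite upd_neq //; have [->|li] := eqVneq l i.
  rewrite upd_eq; apply: (dder_mul_inv hK (c := 1) (h := 'X_ord_max)) gH _.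
  - by rewrite ddirX pi ext_pt_max.
  - exact: oner_neq0.
  - by rewrite prednK // -fE.
rewrite upd_neq //; have := fU l; rewrite fE dder_mulc; last first.
  by rewrite ddirX pl // ext_pt_max.
by move/eqP; rewrite mulf_eq0 (negPf (mpolyX_neq0 _ _)) => /eqP.
Qed.

End LineDegeneration.

Lemma top_subset s (m : 'I_s -> nat) (S : {set 'I_s}) n :
  (n <= #|S|)%N -> exists A : {set 'I_s}, [/\ A \subset S, #|A| = n &
    forall i j, i \in A -> j \in S -> j \notin A -> (m j <= m i)%N].
Proof.
elim: n => [|n IHn] le_n.
  by exists set0; rewrite sub0set cards0; split=> // i j; rewrite inE.
have [A [sAS cA topA]] := IHn (ltnW le_n).
have [x0 x0D] : exists x, x \in S :\: A.
  by apply/set0Pn; rewrite -card_gt0 cardsD (setIidPr sAS) cA subn_gt0.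
case: (@arg_maxnP _ x0 (mem (S :\: A)) m x0D) => x xD maxx.
have /setDP[xS xA] : x \in S :\: A by [].
exists (x |: A); split.
- by rewrite subUset sub1set xS.
- by rewrite cardsU1 xA cA.
move=> i j; rewrite !inE => iA jS; rewrite negb_or => /andP[jx jA].
case/predU1P: iA => [->|iA]; last exact: topA.
by apply: maxx; rewrite /= inE jA.
Qed.

(** * Nonempty systems and simple points *)

Section Positivity.
Variables (K : fieldType) (hK : [pchar K] =i pred0) (s : nat).

Lemma fatsys_mul_gt0 n (p : 'I_s -> 'I_n.+1 -> K) d1 d2 a1 a2 a :
  (0 < \dim (fatsys p d1 a1))%N -> (0 < \dim (fatsys p d2 a2))%N ->
  (forall i, (a1 i + a2 i).-1 <= a i)%N ->
  (0 < \dim (fatsys p (d1 + d2) a))%N.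
Proof.
case/fatsys_pick => f [fH f0 fa] /fatsys_pick[g [gH g0 ga]] le_a.
apply: (@fatsys_neq0 _ _ _ _ _ _ (f * g)); rewrite ?mulf_neq0 ?dhomogM // => i.
exact: dder_eq0_leq (le_a i) (dder_mul0 (fa i) (ga i)).
Qed.

(** At most [n] equations on [n.+1] coefficients. In degree one, exponent 1 means passing through
    the point and exponent 2 means no condition. *)
Lemma fatsys_hyperplane n (p : 'I_s -> 'I_n.+1 -> K) (A : {set 'I_s}) :
  (#|A| <= n)%N ->
  (0 < \dim (fatsys p 1 (fun i => if i \in A then 1 else 2)%N))%N.
Proof.
move=> leA; pose P : 'M[K]_(n.+1, #|A|) := \matrix_(j, y) p (enum_val y) j.
have : kermx P != 0.
  by rewrite kermx_eq0 /row_free; have := rank_leq_col P; lia.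
case/matrix0Pn => k [l kl].
pose c j := kermx P k j.
have cP : row k (kermx P) *m P = 0 by rewrite -row_mul mulmx_ker row0.
apply: (@fatsys_neq0 _ _ _ _ _ _ (lform c)); first exact: lform_homog.
  exact: (lform_neq0 (j := l)).
move=> i; case: ifP => iA; last by apply: dder_gt_deg (lform_homog c) _.
rewrite dderSr /= ddir_lform; suff -> : \sum_j c j * p i j = 0 by rewrite mpolyC0.
have /rowP/(_ (enum_rank_in iA i)) := cP.
rewrite mxE [RHS]mxE => cP0; rewrite -[RHS]cP0; apply: eq_bigr => j _.
by rewrite [row _ _ _ _]mxE [P _ _]mxE enum_rankK_in.
Qed.

(** With multiplicities [d.+1 - a i] of sum at most [n * d], a product of [d] hyperplanes works,
    each through [n] points of largest remaining multiplicity. *)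
Lemma fatsys_hyperplanes n (p : 'I_s -> 'I_n.+1 -> K) d a :
  (forall i, 0 < a i)%N -> (\sum_i (d.+1 - a i) <= n * d)%N ->
  (0 < \dim (fatsys p d a))%N.
Proof.
elim: d a => [|d IHd] a a0 le_sum.
  apply: (@fatsys_neq0 _ _ _ _ _ _ 1); rewrite ?oner_neq0 ?dhomog1 // => i.
  by apply: dder_gt_deg (a0 i); apply: dhomog1.
have [|A [_ cA topA]] := @top_subset s (fun i => d.+2 - a i)%N setT (minn n s).
  by rewrite cardsT card_ord geq_minr.
have leA : (#|A| <= n)%N by rewrite cA geq_minl.
have sumA (F : 'I_s -> nat) :
    (\sum_i F i = \sum_(i in A) F i + \sum_(i in ~: A) F i)%N.
  rewrite (bigID (mem A)) /=; congr (_ + _)%N.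
  by apply: eq_bigl => i; rewrite inE.
have leA1 (F : 'I_s -> nat) c : (forall i, i \in A -> F i <= c)%N ->
    (\sum_(i in A) F i <= #|A| * c)%N.
  by move=> H; rewrite -sum_nat_const; apply: leq_sum.
have geA1 (F : 'I_s -> nat) c : (forall i, i \in A -> c <= F i)%N ->
    (#|A| * c <= \sum_(i in A) F i)%N.
  by move=> H; rewrite -sum_nat_const; apply: leq_sum.
(* A point off [A] of multiplicity [d.+1] would give [n.+1] such points, too many for the sum. *)
have offA i : i \notin A -> (1 < a i)%N.
  move=> iA; rewrite ltnNge; apply/negP => ai.
  have iAC : i \in ~: A by rewrite inE.
  have ltA : (#|A| < s)%N.
    by have := cardsC A; rewrite card_ord (cardsD1 i (~: A)) iAC; lia.
  have cAn : #|A| = n by lia.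
  have le_n : (n * d.+1 <= \sum_(k in A) (d.+2 - a k))%N.
    rewrite -{1}cAn; apply: geA1 => k kA.
    by have := topA k i kA (in_setT _) iA; have := a0 i; lia.
  have le_i : (d.+1 <= \sum_(k in ~: A) (d.+2 - a k))%N.
    by rewrite (bigD1 i) //=; have := a0 i; lia.
  by have := leq_add le_n le_i; rewrite -sumA; lia.
pose a' i := if i \in A then a i else (a i).-1.
have V' : (0 < \dim (fatsys p d a'))%N.
  apply: IHd => [i|].
    by rewrite /a'; case: ifPn => // /offA; lia.
  rewrite sumA /a'.
  rewrite (eq_bigr (fun i => d.+1 - a i)%N); last by move=> i ->.
  rewrite [X in (_ + X)%N](eq_bigr (fun i => d.+2 - a i)%N); last first.
    by move=> i; rewrite inE => iA; rewrite (negPf iA); have := offA _ iA; lia.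
  have le1 : (\sum_(i in A) (d.+1 - a i) <= #|A| * d)%N.
    by apply: leA1 => i _; have := a0 i; lia.
  (* If some point of [A] has multiplicity 0, so have all points off [A], and those in [A] fit by
     size. Otherwise either [A] is everything or the sum drops by exactly [n]. *)
  have [/existsP[i /andP[iA /eqP mi]]|] :=
      boolP [exists i, (i \in A) && (d.+2 - a i == 0)%N].
    rewrite [X in (_ + X)%N]big1 ?addn0.
      by apply: (leq_trans le1); rewrite leq_mul2r leA orbT.
    by move=> k; rewrite inE => kA; have := topA i k iA (in_setT _) kA; lia.
  rewrite negb_exists => /forallP nz.
  have [Afull|Asmall] := eqVneq (~: A) set0.
    rewrite Afull big_set0 addn0.
    by apply: (leq_trans le1); rewrite leq_mul2r leA orbT.
  have cAn : #|A| = n.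
    by have := cardsC A; rewrite card_ord; move: Asmall; rewrite -card_gt0; lia.
  have eqA : (\sum_(i in A) (d.+2 - a i) = \sum_(i in A) (d.+1 - a i) + #|A|)%N.
    rewrite -sum1_card -big_split; apply: eq_bigr => i iA /=.
    by have := nz i; rewrite iA /=; lia.
  move: le_sum; rewrite sumA /= eqA cAn mulnS => le_sum.
  by rewrite -(leq_add2r n) addnAC [(n * d + n)%N]addnC.
rewrite -add1n; apply: (fatsys_mul_gt0 (fatsys_hyperplane p leA) V') => i.
by rewrite /a'; case: ifPn => // /offA; lia.
Qed.

(** Exponent [d] is a simple point; its derivative lands in degree 0, so it costs at most one
    dimension. *)
Lemma fatsys_simple_ge n (p : 'I_s -> 'I_n.+1 -> K) d (T : {set 'I_s}) :
  ('C(d + n, d) <=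
   \dim (fatsys p d (fun i => if i \in T then d else d.+1)) + #|T|)%N.
Proof.
have [c] := ubnP #|T|; elim: c T => // c IHc T le_c.
have [->|[x xT]] := set_0Vmem T.
  rewrite cards0 addn0 -[leqLHS](dimvf (dhomog n.+1 K d)).
  apply: dimvS; apply/subvP => f _; apply/fatsysP => i; rewrite inE.
  by apply: dder_gt_deg (ltnSn d); apply: dhomog_is_dhomog.
have := IHc (T :\ x); rewrite (cardsD1 x T) xT /= in le_c * => H.
apply: (leq_trans (H _)) => //; rewrite addnA leq_add2r.
have := fatsys_drop_le p (fun i => if i \in T then d else d.+1) x (ltnSn d).
rewrite xT subnn => H1.
have le1 : (\dim (fatsys p 0 (upd (fun i => if i \in T then d else d.+1) x d.+1)) <= 1)%N.
  apply: (leq_trans (dimvS (subvf _))); rewrite dimvf.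
  by change ('C(0 + n, 0) <= 1)%N; rewrite bin0.
have -> : fatsys p d (fun i => if i \in T :\ x then d else d.+1) =
          fatsys p d (upd (fun i => if i \in T then d else d.+1) x d.+1).
  apply/vspaceP => f; apply/fatsysP/fatsysP => E i; have := E i;
  by rewrite /upd !inE; case: eqP.
by apply: (leq_trans H1); rewrite leq_add2l.
Qed.

(** Move [x] to a point [v] where some member [f] is nonzero: the [d]-th derivative of [f] along [v]
    takes the value [d! f(v)] at [v], so [f] is excluded. *)
Lemma fatsys_add_simple n (p : 'I_s -> 'I_n.+1 -> K) d (a : 'I_s -> nat) x b :
  a x = d -> (d < b)%N -> (0 < \dim (fatsys p d (upd a x b)))%N ->
  exists p' : 'I_s -> 'I_n.+1 -> K,
    (\dim (fatsys p' d a) < \dim (fatsys p d (upd a x b)))%N.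
Proof.
move=> ax lt_b V0; have [f [fH f0 fa]] := fatsys_pick V0.
have [v fv] := homog_nonroot hK fH f0.
exists (upd p x v); set W := fatsys _ d a; set U := fatsys _ _ _.
have sWU : (W <= U)%VS.
  apply/subvP => g /fatsysP gW; apply/fatsysP => i; have := gW i; rewrite /upd.
  by case: eqP => // _ _; apply: dder_gt_deg lt_b; apply: dhomog_is_dhomog.
rewrite ltnNge; apply/negP => leUW.
have WU : W = U by apply/eqP; rewrite eqEdim sWU.
have : DHomog fH \in W by rewrite WU; apply/fatsysP.
move/fatsysP/(_ x); rewrite upd_eq ax /= => /(congr1 (meval v)).
rewrite (dder_meval _ _ fH) meval0 => /eqP.
by rewrite mulf_eq0 (negPf fv) orbF natr_eq0_char0 // ffactnn -leqn0 leqNgt fact_gt0.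
Qed.

End Positivity.

(** * The numbers [F(d; a)] *)

(* The coefficient of [t^d] in [P / (1 - t)^N]. *)
Fixpoint frob N d (P : {poly int}) : int :=
  if N is N'.+1 then \sum_(j < d.+1) frob N' j P else P`_d.

Lemma frob_ext N d (P Q : {poly int}) : (forall j, (j <= d)%N -> P`_j = Q`_j) ->
  frob N d P = frob N d Q.
Proof.
elim: N d => [|N IHN] d H /=; first exact: H.
apply: eq_bigr => j _; apply: IHN => k le_kj; apply: H.
by have := ltn_ord j; lia.
Qed.

Lemma frobB N d P Q : frob N d (P - Q) = frob N d P - frob N d Q.
Proof.
elim: N d => [|N IHN] d /=; first by rewrite coefB.
by rewrite -sumrB; apply: eq_bigr.
Qed.

Lemma frob0 N d : frob N d 0 = 0.
Proof. by rewrite -(subrr 0) frobB subrr. Qed.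

Lemma frobD N d P Q : frob N d (P + Q) = frob N d P + frob N d Q.
Proof.
elim: N d => [|N IHN] d /=; first by rewrite coefD.
by rewrite -big_split; apply: eq_bigr.
Qed.

Lemma frobXnM N d k P :
  frob N d ('X^k * P) = if (k <= d)%N then frob N (d - k) P else 0.
Proof.
elim: N d => [|N IHN] d; first by rewrite /= coefXnM ltnNge; case: leqP.
rewrite /=; under eq_bigr => j _ do rewrite IHN.
elim: d => [|d IHd].
  by rewrite big_ord1; case: k {IHN} => //=; rewrite big_ord1.
rewrite big_ord_recr /= IHd; case: (ltngtP k d.+1) => lt_k.
- by have le_kd : (k <= d)%N by []; rewrite le_kd subSn // [RHS]big_ord_recr.
- by rewrite leqNgt (ltnW lt_k) addr0.
by rewrite lt_k ltnn add0r subnn big_ord1.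
Qed.

Lemma frob_pascal N d P : frob N.+1 d ((1 - 'X) * P) = frob N d P.
Proof.
rewrite mulrBl mul1r frobB -['X]expr1 frobXnM /= big_ord_recr /=.
case: d => [|d]; first by rewrite big_ord0 add0r subr0.
by rewrite subn1 addrC addrK.
Qed.

Lemma frobS N d P : frob N.+1 d P = \sum_(j < d.+1) frob N j P.
Proof. by []. Qed.

Lemma frob1 n d : frob n.+1 d 1 = 'C(n + d, n)%:Z.
Proof.
elim: n d => [|n IHn] d.
  rewrite /= big_ord_recl coef1 big1 => [|j _]; last by rewrite coef1.
  by rewrite bin0 addr0.
elim: d => [|d IHd].
  by rewrite frobS big_ord1 IHn !addn0 !binn.
rewrite frobS big_ord_recr -frobS IHd IHn.
by rewrite -[(n.+1 + d.+1)%N]/((n + d.+1).+1) binS addnS addSn PoszD.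
Qed.

Lemma frobXn n d k :
  frob n.+1 d 'X^k = if (k <= d)%N then 'C(n + (d - k), n)%:Z else 0.
Proof. by rewrite -['X^k]mulr1 frobXnM; case: ifP => // _; rewrite frob1. Qed.

Section FrobergNumber.
Variable s : nat.
Implicit Types (a : 'I_s -> nat) (x i j : 'I_s).

(** The number [F(d; a)]: the Fröberg-Iarrobino prediction, before truncation, for the degree [d]
    part of the quotient by powers [a i] of linear forms, which is dual to [V(d; a)]. *)
Definition froberg n d a : int := frob n.+1 d (\prod_i (1 - 'X^(a i))).

Lemma frob_big_exp N d b P : (d < b)%N -> frob N d ((1 - 'X^b) * P) = frob N d P.
Proof.
by move=> lt_db; rewrite mulrBl mul1r frobB frobXnM leqNgt lt_db subr0.
Qed.

Lemma prod_split a x : \prod_i (1 - 'X^(a i)) =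
  (1 - 'X^(a x)) * \prod_(i | i != x) (1 - 'X^(a i)) :> {poly int}.
Proof. by rewrite (bigD1 x). Qed.

Lemma prod_upd a x b : \prod_i (1 - 'X^(upd a x b i)) =
  (1 - 'X^b) * \prod_(i | i != x) (1 - 'X^(a i)) :> {poly int}.
Proof.
rewrite (prod_split _ x) upd_eq; congr (_ * _); apply: eq_bigr => i ix.
by rewrite upd_neq.
Qed.

(** Expand the factor at [x]; a factor with exponent [b > d] is invisible up to degree [d]. This is
    the numerical equality matching [fatsys_drop_le]. *)
Lemma froberg_drop n d a x b : (a x <= d)%N -> (d < b)%N ->
  froberg n d a = froberg n d (upd a x b) - froberg n (d - a x) (upd a x b).
Proof.
move=> le_ax lt_db; rewrite /froberg (prod_split a x) !prod_upd.
rewrite mulrBl mul1r frobB frobXnM le_ax.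
by rewrite !frob_big_exp // (leq_ltn_trans (leq_subr _ _)).
Qed.

Lemma froberg_exp0 n d a x : a x = 0%N -> froberg n d a = 0.
Proof. by move=> a0; rewrite /froberg (prod_split a x) a0 subrr mul0r frob0. Qed.

Lemma eq_froberg n d a a' :
  (forall i, a i = a' i \/ (d < a i)%N /\ (d < a' i)%N) ->
  froberg n d a = froberg n d a'.
Proof.
move=> E; rewrite /froberg; apply: frob_ext.
(* Congruence modulo [t^(d + 1)], which is compatible with products. *)
pose R (P Q : {poly int}) := forall j : nat, (j <= d)%N -> P`_j = Q`_j.
suff H : R (\prod_i (1 - 'X^(a i))) (\prod_i (1 - 'X^(a' i))) by exact: H.
apply: big_ind2 => // [P1 P2 Q1 Q2 H1 H2 j le_jd|i _ j le_jd].
  rewrite !coefM; apply: eq_bigr => k _; have lt_k := ltn_ord k.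
  by rewrite H1 ?H2 //; lia.
case: (E i) => [-> //|[lt1 lt2]].
by rewrite !coefB !coefXn !ltn_eqF //; lia.
Qed.

Lemma froberg_irrelevant n d a : (forall i, (d < a i)%N) ->
  froberg n d a = 'C(n + d, n)%:Z.
Proof.
move=> a_gt; rewrite -frob1 /froberg; apply: frob_ext.
pose R (P : {poly int}) := forall j : nat, (j <= d)%N -> P`_j = (1 : {poly int})`_j.
suff H : R (\prod_i (1 - 'X^(a i))) by exact: H.
apply: big_ind => // [P Q HP HQ j le_jd|i _ j le_jd].
  rewrite -[1 in RHS]mulr1 !coefM; apply: eq_bigr => k _.
  by have := ltn_ord k => lt_k; rewrite HP ?HQ //; lia.
by rewrite coefB coefXn ltn_eqF ?subr0 //; have := a_gt i; lia.
Qed.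

(** By [froberg_drop] both sides are minus a number [F] in the common degree
    [d.+1 - a x = d - a' x], where the differing exponents are too large to matter. *)
Lemma froberg_mul n d a a' x b : a x = (a' x).+1 -> (a x <= d.+1)%N ->
  (d.+1 < b)%N ->
  (forall i, i != x -> a' i = a i \/ (d.+1 - a x < a' i)%N /\ (d.+1 - a x < a i)%N) ->
  froberg n d.+1 a - froberg n d.+1 (upd a x b) =
  froberg n d a' - froberg n d (upd a' x b).
Proof.
move=> ax le_ax lt_b E.
rewrite (@froberg_drop _ d.+1 a x b) // (@froberg_drop _ d a' x b) //; try lia.
have cancel (u v : int) : u - v - u = - v by ring.
rewrite !cancel.
have -> : (d - a' x = d.+1 - a x)%N by lia.
congr (- _); apply: eq_froberg => i; rewrite /upd; case: eqP => [_|/eqP ne].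
  by left.
by case: (E i ne) => [->|[]]; [left | right].
Qed.

(** From [(1 - t^u)(1 - t^w) = (1 - t)(1 - t^(u+w-1)) + t (1 - t^(u-1))(1 - t^(w-1))]; the factor
    [1 - t] lowers the dimension and the factor [t] the degree. *)
Lemma froberg_line n d a i j b : i != j -> (0 < a i)%N -> (0 < a j)%N ->
  (d.+1 < b)%N ->
  froberg n.+1 d.+1 a =
  froberg n d.+1 (trace_exp a i j b) + froberg n.+1 d (resid_exp a i j).
Proof.
move=> ne_ij ai aj lt_b.
have prod2 (c : 'I_s -> nat) : \prod_l (1 - 'X^(c l)) =
    (1 - 'X^(c i)) * ((1 - 'X^(c j)) *
      \prod_(l | (l != i) && (l != j)) (1 - 'X^(c l))) :> {poly int}.
  by rewrite (bigD1 i) //= (bigD1 j) 1?eq_sym.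
pose R : {poly int} := \prod_(l | (l != i) && (l != j)) (1 - 'X^(a l)).
have RE (c : 'I_s -> nat) : (forall l, l != i -> l != j -> c l = a l) ->
    \prod_(l | (l != i) && (l != j)) (1 - 'X^(c l)) = R.
  by move=> H; apply: eq_bigr => l /andP[li lj]; rewrite H.
rewrite /froberg !prod2 -/R !RE; first last.
- by move=> l li lj; rewrite /trace_exp !upd_neq.
- by move=> l li lj; rewrite /resid_exp !upd_neq.
have ji : j != i by rewrite eq_sym.
rewrite /trace_exp /resid_exp !upd_eq (upd_neq _ _ ne_ij) upd_eq.
rewrite (upd_neq _ _ ji) upd_eq (frob_big_exp _ _ lt_b).
have -> : frob n.+2 d ((1 - 'X^((a i).-1)) * ((1 - 'X^((a j).-1)) * R)) =
    frob n.+2 d.+1 ('X^1 * ((1 - 'X^((a i).-1)) * ((1 - 'X^((a j).-1)) * R))).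
  by rewrite frobXnM subn1.
rewrite -(frob_pascal n.+1) -frobD; congr (frob _ _ _).
case: (a i) ai => // u _; case: (a j) aj => // w _.
have -> : ((u.+1 + w.+1).-1 = (u + w).+1)%N by lia.
rewrite ['X^1]expr1 ['X^(u.+1)]exprS ['X^(w.+1)]exprS ['X^((u + w).+1)]exprS.
rewrite exprD !succnK.
by clear RE; move: ('X^u : {poly int}) ('X^w : {poly int}) R => A B R'; ring.
Qed.

End FrobergNumber.

Lemma ldim_virt_froberg n d s (m : 'I_s -> nat) : (forall i, m i <= d)%N ->
  ldim_virt n d m = froberg n d (fun i => d.+1 - m i)%N - 1.
Proof.
move=> le_md; rewrite /ldim_virt /froberg; congr (_ - 1).
under [in RHS]eq_bigr => i _ do rewrite addrC.
rewrite bigA_distr (big_morph _ (frobD n.+1 d) (frob0 n.+1 d)).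
apply: eq_big => // I _; pose k := (\sum_(i in I) (d.+1 - m i))%N.
have -> : \prod_i (if i \in I then - 'X^(d.+1 - m i) else 1) =
    (-1) ^+ #|I| *: 'X^k :> {poly int}.
  rewrite -big_mkcond /= prodrN cardE /k -prodrXr -cardE -mul_polyC.
  by rewrite rmorphXn /= polyCN.
have -> : frob n.+1 d ((-1) ^+ #|I| *: 'X^k) = (-1) ^+ #|I| * frob n.+1 d 'X^k.
  by rewrite -signr_odd; case: odd;
     rewrite ?expr0 ?expr1 ?scale1r ?mul1r ?scaleN1r ?mulN1r //
             -[- 'X^k]sub0r frobB frob0 sub0r.
congr (_ * _); rewrite frobXn /kI.
pose M := (\sum_(i in I) m i)%N.
have -> : \sum_(i in I) (m i)%:Z = M%:Z by rewrite /M (big_morph Posz PoszD (erefl _)).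
have kE : (k + M = #|I| * d.+1)%N.
  rewrite /k /M -big_split -sum_nat_const; apply: eq_bigr => i _ /=.
  by rewrite subnK // leqW.
have I0 : #|I| = 0%N -> k = 0%N by move/cards0_eq; rewrite /k => ->; rewrite big_set0.
(* So [k_I - #|I|], before the truncation at 0, is [d - k], the degree left after the factor
   [t^k]. *)
have -> : M%:Z - (#|I|%:Z - 1) * d%:Z = d%:Z + #|I|%:Z - k%:Z.
  by rewrite mulrBl mul1r -PoszM; move: kE; rewrite mulnS; lia.
move: {kE} I0 => I0; case: leqP => [le_kd|lt_dk].
  have -> : Num.max (d%:Z + #|I|%:Z - k%:Z) 0 = d%:Z + #|I|%:Z - k%:Z by lia.
  by have -> : n%:Z + (d%:Z + #|I|%:Z - k%:Z) - #|I|%:Z = (n + (d - k))%:Z by lia.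
(* When [k > d] the upper entry of the binomial is below [n], possibly negative, and the term
   vanishes. *)
have I1 : (0 < #|I|)%N by lia.
set z := n%:Z + _ - _; have : z < n%:Z by rewrite /z; lia.
by case: z => //= z lt_z; rewrite bin_small.
Qed.

(** * The numerical range *)

Section Range.
Variable s : nat.
Implicit Types (a : 'I_s -> nat) (x i j l : 'I_s).

(** In terms of multiplicities [d.+1 - a i]: the points of positive multiplicity, and those of
    multiplicity [d]. *)
Definition relev d a : {set 'I_s} := [set i | (a i <= d)%N].
Definition ones a : {set 'I_s} := [set i | a i == 1%N].

(* With multiplicities [m i = d.+1 - a i], the two inequalities say
   [\sum m <= n d + (n - s(d))] and [\sum m <= n d + (s - n - 2)]. *)
Definition in_range n d a : Prop :=
  (forall i, 0 < a i)%N /\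
  ((#|relev d a| <= n.+1)%N \/
   (\sum_i (d.+1 - a i) + #|ones a| <= n * d.+1)%N /\
   (\sum_i (d - a i) + n + 2 <= n * d)%N).

Lemma in_range_mono n d a (b : 'I_s -> nat) : (forall i, (a i <= b i)%N) ->
  in_range n d a -> in_range n d b.
Proof.
move=> le_ab [a0 H]; split=> [i|]; first exact: leq_trans (a0 i) (le_ab i).
case: H => [H|[H1 H2]]; [left|right].
  apply: leq_trans H; apply: subset_leq_card; apply/subsetP => i.
  by rewrite !inE; apply: leq_trans.
have ones_le : (#|ones b| <= #|ones a|)%N.
  apply: subset_leq_card; apply/subsetP => i; rewrite !inE => /eqP b1.
  by have := a0 i; have := le_ab i; lia.
have sum_le e : (\sum_i (e - b i) <= \sum_i (e - a i))%N.
  by apply: leq_sum => i _; apply: leq_sub2l.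
by split; [have := sum_le d.+1 | have := sum_le d]; lia.
Qed.

Lemma sum_relev d a : (\sum_i (d.+1 - a i) = \sum_i (d - a i) + #|relev d a|)%N.
Proof.
rewrite -sum1_card [X in (_ + X)%N]big_mkcond -big_split /=.
by apply: eq_bigr => i _; rewrite inE; case: leqP; lia.
Qed.

(** Lowering the degree by one takes one from every positive multiplicity. While more than [n.+1]
    points remain, the left sides fall by more than the [n] lost on the right. *)
Lemma in_range_deg n d e a : (e <= d)%N -> in_range n d a -> in_range n e a.
Proof.
move=> le_ed; rewrite -(subnK le_ed); elim: (d - e)%N => // k IHk.
rewrite addSn => R; apply: IHk; case: R => a0 R; split=> //.
have [|gt_n] := leqP #|relev (k + e) a| n.+1; [by left | right].
have rel_le : (#|relev (k + e) a| <= #|relev (k + e).+1 a|)%N.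
  apply: subset_leq_card; apply/subsetP => i; rewrite !inE; lia.
case: R => [|[]]; first by lia.
rewrite (sum_relev (k + e).+1) (sum_relev (k + e)) !mulnS; lia.
Qed.

(** The trace after [t] residuations: the exponents at [i] and [j] have each dropped by [t], and [i]
    is deleted. *)
Definition line_exp a i j (b t : nat) : 'I_s -> nat := fun l =>
  if l == i then b else if l == j then (a i + a j - t.*2).-1 else a l.

Lemma sum_line_exp a i j b t e : i != j -> (e <= b)%N ->
  (\sum_l (e - line_exp a i j b t l) =
   \sum_(l | (l != i) && (l != j)) (e - a l) + (e - (a i + a j - t.*2).-1))%N.
Proof.
move=> ne_ij le_eb; rewrite (bigD1 i) //= (bigD1 j) 1?eq_sym //=.
rewrite /line_exp eqxx eq_sym (negPf ne_ij) eqxx (eqP le_eb) add0n addnC.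
by congr (_ + _)%N; apply: eq_bigr => l /andP[/negPf -> /negPf ->].
Qed.

Lemma sum_split2 a i j e : i != j ->
  (\sum_l (e - a l) =
   \sum_(l | (l != i) && (l != j)) (e - a l) + (e - a i) + (e - a j))%N.
Proof.
move=> ne_ij; rewrite (bigD1 i) //= (bigD1 j) 1?eq_sym //=; lia.
Qed.

Lemma card_relev_split a i j d : i != j ->
  (#|relev d a| = \sum_(l | (l != i) && (l != j)) (a l <= d)
     + (a i <= d) + (a j <= d))%N.
Proof.
move=> ne_ij; have -> : (#|relev d a| = \sum_l (a l <= d))%N.
  rewrite -sum1_card big_mkcond; apply: eq_bigr => l _.
  by rewrite inE; case: leqP.
by rewrite (bigD1 i) //= (bigD1 j) 1?eq_sym //=; lia.
Qed.

(** Here [i] has multiplicity [d], members are cones over it, and the trace amounts to projecting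
    from it: the sum loses [d], and there is one point of multiplicity [d] fewer. *)
Lemma in_range_cone n d a i j : in_range n.+1 d a -> (n.+2 < #|relev d a|)%N ->
  i != j -> a i = 1%N -> (a j <= d)%N -> in_range n d (line_exp a i j d.+1 0).
Proof.
move=> [a0 R] gt_n ne_ij ai aj.
case: R => [|[R1 R2]]; first by lia.
have d0 : (0 < d)%N by have := a0 j; lia.
have a'0 l : (0 < line_exp a i j d.+1 0 l)%N.
  rewrite /line_exp; case: eqP => // _; case: eqP => // _.
  by have := a0 j; rewrite ai; lia.
split=> //; right.
have ones_le : (#|ones (line_exp a i j d.+1 0)| < #|ones a|)%N.
  rewrite (cardsD1 i (ones a)) inE ai eqxx ltnS; apply: subset_leq_card.
  apply/subsetP => l; rewrite !inE /line_exp; case: (l =P i) => [_ /eqP|_ /=]; first by lia.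
  by case: (l =P j) => [->|//]; rewrite ai add1n subn0.
rewrite !sum_line_exp //; move: R1 R2; rewrite !(sum_split2 _ _ ne_ij) ai.
rewrite double0 subn0 add1n /= subn1 /= !mulSn.
move: (\sum_(l | _) (d.+1 - a l))%N (\sum_(l | _) (d - a l))%N => S1 S.
by move: ones_le; move: #|ones a| #|ones _| => o o'; split; lia.
Qed.

Lemma in_range_line n d a i j t : in_range n.+1 d a ->
  (n.+2 < #|relev d a|)%N -> (forall l, 1 < a l)%N -> i != j ->
  (a i + a j <= d.+1)%N -> (\sum_l (d.+1 - a l) < n.+1 * d.+1)%N ->
  (t < a i)%N -> (t < a j)%N -> in_range n (d - t) (line_exp a i j d.+1 t).
Proof.
move=> [a0 R] gt_n a1 ne_ij aij sum_lt ti tj.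
case: R => [|[_ R2]]; first by lia.
pose q := (a i + a j - t.*2).-1; have q0 : (0 < q)%N by rewrite /q; lia.
split=> [l|].
  by rewrite /line_exp; case: eqP => // _; case: eqP => // _.
have [|gt_rel] := leqP #|relev (d - t) (line_exp a i j d.+1 t)| n.+1; [by left|right].
pose u := (\sum_(l | (l != i) && (l != j)) (a l <= d - t))%N.
pose r := (\sum_(l | (l != i) && (l != j)) (a l <= d))%N.
have ai1 := a1 i; have aj1 := a1 j.
have rE : #|relev d a| = r.+2.
  by rewrite (card_relev_split _ _ ne_ij) -/r; lia.
have uE : #|relev (d - t) (line_exp a i j d.+1 t)| = u.+1.
  have Ei : line_exp a i j d.+1 t i = d.+1 by rewrite /line_exp eqxx.
  have Ej : line_exp a i j d.+1 t j = q.
    by rewrite /line_exp [j == i]eq_sym (negPf ne_ij) eqxx.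
  rewrite (card_relev_split _ _ ne_ij) Ei Ej.
  rewrite (eq_bigr (fun l => (a l <= d - t)%N : nat)) -/u; last first.
    by move=> l /andP[/negPf li /negPf lj]; rewrite /line_exp li lj.
  by rewrite /q; lia.
(* Only the new point on the line can have exponent 1; the strict inequality on the sum makes room
   for it. *)
have ones_le : (#|ones (line_exp a i j d.+1 t)| <= (q == 1))%N.
  have [q1|q1] := boolP (q == 1)%N.
    rewrite -[nat_of_bool true](cards1 j); apply: subset_leq_card; apply/subsetP => l.
    rewrite !inE /line_exp; case: (l =P i) => [_ /eqP|_]; first by lia.
    by case: (l =P j) => // _ /eqP; have := a1 l; lia.
  rewrite leqn0 cards_eq0; apply/eqP/setP => l; rewrite !inE /line_exp.
  case: (l =P i) => [_|_]; first by apply/negbTE/eqP; lia.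
  by case: (l =P j) => [_|_]; apply/negbTE; rewrite // neq_ltn a1 orbT.
have ur : (u <= r)%N by apply: leq_sum => l _; lia.
rewrite !sum_line_exp //; try lia.
rewrite -/q; move: R2 sum_lt; have := sum_relev d a.
rewrite !(sum_split2 _ _ ne_ij) rE.
set S1 := (\sum_(l | _) (d.+1 - a l))%N; set S := (\sum_(l | _) (d - a l))%N.
set S1' := (\sum_(l | _) ((d - t).+1 - a l))%N; set S' := (\sum_(l | _) (d - t - a l))%N.
move=> SE R2 sum_lt.
(* Each of the [u] old points still relevant in degree [d - t] has lost [t], and [u] is at least
   [n.+1]. *)
have S'le : (S' + u * t <= S)%N.
  rewrite /S' /u /S big_distrl -big_split /=; apply: leq_sum => l _.
  by case: (leqP (a l) (d - t)); lia.
have S1'le : ((0 < t) * (u * t.-1 + r) + S1' <= S1)%N.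
  rewrite /S1' /u /S1 /r; case: posnP => [->|t0]; first by rewrite subn0.
  rewrite mul1n big_distrl -!big_split /=; apply: leq_sum => l _.
  by case: (leqP (a l) (d - t)); case: (leqP (a l) d); lia.
have ut : (n.+1 * t <= u * t)%N by rewrite leq_mul2r; apply/orP; right; lia.
split; last first.
  rewrite mulnBr; move: R2; rewrite mulSn; move: ut; rewrite mulSn.
  have : (n * t <= n * d)%N by rewrite leq_mul2l; apply/orP; right; lia.
  by rewrite /q; lia.
have [t0|t0] := posnP t.
  have q1 : (q == 1)%N = false by apply/negbTE/eqP; rewrite /q; lia.
  have q_le : ((d - t).+1 - q <= d.+2 - (a i + a j))%N by rewrite /q; lia.
  move: ones_le S1'le q_le; rewrite q1 leqn0 cards_eq0 => /eqP ->; rewrite cards0.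
  clearbody S1 S1' q; move: sum_lt; rewrite t0 subn0 mul0n add0n !mulSn; lia.
have ut1 : (n.+1 * t.-1 <= u * t.-1)%N by rewrite leq_mul2r; apply/orP; right; lia.
move: S1'le; rewrite t0 mul1n => S1'le.
have nt : (n * t <= n * d)%N by rewrite leq_mul2l; apply/orP; right; lia.
have tE : (n * t = n * t.-1 + n)%N by rewrite -{1}(prednK t0) mulnS addnC.
have -> : (n * (d - t).+1 = n * d + n - n * t)%N by rewrite mulnS mulnBr; lia.
move: sum_lt R2 ut1; rewrite !mulSn !mulnS => sum_lt R2 ut1.
have [ru|ru] := ltnP n.+1 r.
  by move: ones_le; rewrite /q; case: eqP => /=; lia.
have n0 : (0 < n)%N.
  by rewrite lt0n; apply/eqP => n0; move: R2; rewrite n0; lia.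
by move: ones_le; rewrite /q; case: eqP => /=; lia.
Qed.

End Range.

(** * Upper bounds at special configurations *)

Section Main.
Variables (K : fieldType) (hK : [pchar K] =i pred0) (s : nat).
Implicit Types (a : 'I_s -> nat) (x i j l : 'I_s).

Definition exact_dim n d a : Prop :=
  @generic K s n (fun p => (\dim (fatsys p d a))%:Z = froberg n d a).

Definition small_config n d a : Prop :=
  exists p : 'I_s -> 'I_n.+1 -> K, (\dim (fatsys p d a))%:Z <= froberg n d a.

Lemma eq_fatsys_exp n (p : 'I_s -> 'I_n.+1 -> K) d a a' :
  (forall i, a i = a' i) -> fatsys p d a = fatsys p d a'.
Proof.
by move=> E; apply/vspaceP => f; apply/fatsysP/fatsysP => H i; rewrite -(H i) E.
Qed.

Lemma exact_dim_exp0 n d a x : a x = 0%N -> exact_dim n d a.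
Proof.
move=> a0; apply: generic_true => p.
by rewrite (fatsys_exp0 _ _ a0) (froberg_exp0 _ _ a0).
Qed.

Lemma exact_dim_irrelevant n d a : (forall i, d < a i)%N -> exact_dim n d a.
Proof.
move=> a_gt; apply: generic_true => p; rewrite froberg_irrelevant //.
have -> : fatsys p d a = fullv.
  apply/vspaceP => f; rewrite memvf; apply/fatsysP => i.
  by apply: dder_gt_deg (a_gt i); apply: dhomog_is_dhomog.
rewrite dimvf; congr Posz; change ('C(d + n, d) = 'C(n + d, n)).
by rewrite -bin_sub ?leq_addr // addKn addnC.
Qed.

(** The bound below comes from [fatsys_drop_le] and [froberg_drop]; the bound above spreads from one
    configuration by semicontinuity. *)
Lemma exact_dim_of n d a x b : (a x <= d)%N -> (d < b)%N ->
  exact_dim n d (upd a x b) -> exact_dim n (d - a x) (upd a x b) ->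
  small_config n d a -> exact_dim n d a.
Proof.
move=> le_ax lt_db E1 E2 [p0 Hp0].
have := generic_and hK (generic_and hK E1 E2) (fatsys_semicontinuous d a p0).
apply: generic_imp => p [[H1 H2] H3].
have := fatsys_drop_le p a x lt_db; move: Hp0; rewrite (froberg_drop _ le_ax lt_db).
rewrite -H1 -H2; lia.
Qed.

(** Iterate [fatsys_line_le] and [froberg_line] until the exponent at [i] or [j] is 0, where both
    sides vanish. One [p'] must serve all the traces. *)
Lemma line_config_le n (p' : 'I_s -> 'I_n.+1 -> K) i j b d a :
  i != j -> (d < b)%N -> (minn (a i) (a j) <= d)%N ->
  (forall t, (t < minn (a i) (a j))%N ->
    (\dim (fatsys p' (d - t) (line_exp a i j b t)))%:Z =
    froberg n (d - t) (line_exp a i j b t)) ->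
  (\dim (fatsys (line_config p' i j) d a))%:Z <= froberg n.+1 d a.
Proof.
move=> ne_ij; move E: (minn (a i) (a j)) => k.
elim: k d a E => [|k IHk] d a E lt_b le_k H.
  have [a0|a0] : a i = 0%N \/ a j = 0%N by lia.
    by rewrite (fatsys_exp0 _ _ a0) (froberg_exp0 _ _ a0).
  by rewrite (fatsys_exp0 _ _ a0) (froberg_exp0 _ _ a0).
case: d => // d in lt_b le_k H *.
have [ai aj] : (0 < a i)%N /\ (0 < a j)%N by lia.
have := fatsys_line_le hK p' ne_ij ai aj lt_b.
rewrite (froberg_line n ne_ij ai aj lt_b).
have trE l : trace_exp a i j b l = line_exp a i j b 0 l.
  rewrite /trace_exp /line_exp /upd double0 subn0; case: eqP => // _.
have ji : (j == i) = false by rewrite eq_sym (negPf ne_ij).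
have ri : resid_exp a i j i = (a i).-1.
  by rewrite /resid_exp /upd (negPf ne_ij) eqxx.
have rj : resid_exp a i j j = (a j).-1 by rewrite /resid_exp /upd eqxx.
have reE t l : line_exp (resid_exp a i j) i j b t l = line_exp a i j b t.+1 l.
  rewrite /line_exp ri rj; case: (l =P i) => // li; case: (l =P j) => [_|lj].
    by rewrite doubleS; lia.
  by rewrite /resid_exp !upd_neq //; apply/eqP.
have := IHk d (resid_exp a i j); rewrite ri rj => /(_ _ (ltnW lt_b) le_k) IH.
have {}IH : (\dim (fatsys (line_config p' i j) d (resid_exp a i j)))%:Z <=
    froberg n.+1 d (resid_exp a i j).
  apply: IH => [|t lt_tk]; first by lia.
  rewrite (eq_fatsys_exp _ _ (reE t)) (@eq_froberg _ _ _ _ (line_exp a i j b t.+1)).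
    exact: (H t.+1).
  by move=> l; left.
have := H 0%N isT; rewrite subn0 => H0.
rewrite (eq_fatsys_exp _ _ trE) (@eq_froberg _ _ _ _ (line_exp a i j b 0)) -?H0.
  by move: IH; lia.
by move=> l; left.
Qed.

Lemma small_config_line n d a i j : i != j -> (minn (a i) (a j) <= d)%N ->
  (forall t, (t < minn (a i) (a j))%N ->
    exact_dim n (d - t) (line_exp a i j d.+1 t)) ->
  small_config n.+1 d a.
Proof.
move=> ne_ij le_d H.
pose Q t (p : 'I_s -> 'I_n.+1 -> K) :=
  (\dim (fatsys p (d - t) (line_exp a i j d.+1 t)))%:Z =
  froberg n (d - t) (line_exp a i j d.+1 t).
have [p' Hp'] := generic_ex (generic_all hK (Q := Q) H).
by exists (line_config p' i j); apply: line_config_le Hp'.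
Qed.

(** Combine [fatsys_mul_le] for a hyperplane through [A] missing [x] with [froberg_mul]; three of
    the four dimensions are already exact. The last condition on [i] off [A] says that the
    multiplicities of [x] and [i] sum to at most the degree. *)
Lemma small_config_mul n d a a' x (A : {set 'I_s}) : (#|A| <= n)%N -> x \notin A ->
  (a x <= d.+1)%N -> a x = (a' x).+1 ->
  (forall i, i != x -> (i \in A) && (a' i == a i) ||
     (a i == (a' i).+1) && (d.+1 - a x < a' i))%N ->
  exact_dim n d.+1 (upd a x d.+2) -> exact_dim n d (upd a' x d.+2) ->
  exact_dim n d a' -> small_config n d.+1 a.
Proof.
move=> leA xA le_ax ax aA E1 E2 E3.
have := generic_and hK (generic_and hK E1 E2)
          (generic_and hK E3 (generic_hyperplane K leA xA)).
case/generic_ex => p [[H1 H2] [H3 [c [cA cx]]]]; exists p.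
have hx : ddir (p x) (lform c) = 1%:MP by rewrite ddir_lform cx.
have := @fatsys_mul_le K s hK n p d a a' x d.+2 (lform c) 1 (lform_homog c) hx
  (oner_neq0 K) ax (ltnSn _).
have := @froberg_mul s n d a a' x d.+2 ax le_ax (ltnSn _).
move=> FE DE; have {}FE : froberg n d.+1 a - froberg n d.+1 (upd a x d.+2) =
    froberg n d a' - froberg n d (upd a' x d.+2).
  apply: FE => i ix; have /orP[/andP[_ /eqP ->]|/andP[/eqP ai lt_i]] := aA i ix.
    by left.
  by right; rewrite ai; lia.
have {}DE : (\dim (fatsys p d.+1 a) + \dim (fatsys p d (upd a' x d.+2)) <=
   \dim (fatsys p d.+1 (upd a x d.+2)) + \dim (fatsys p d a'))%N.
  apply: DE => i ix; have /orP[/andP[iA /eqP ->]|/andP[/eqP ai _]] := aA i ix.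
    by left; rewrite ddir_lform cA.
  by right.
move: FE; rewrite -H1 -H2 -H3; lia.
Qed.

Lemma small_config_simple n d a x : (forall i, 0 < a i)%N -> a x = d ->
  exact_dim n d (upd a x d.+1) -> 0 < froberg n d (upd a x d.+1) ->
  small_config n d a.
Proof.
move=> a0 ax E F0; have [p Hp] := generic_ex E.
have : (0 < \dim (fatsys p d (upd a x d.+1)))%N by rewrite -Hp in F0; lia.
case/(fatsys_add_simple hK ax (ltnSn d)) => p' Hp'; exists p'.
rewrite (@froberg_drop _ n d a x d.+1) ?ax // subnn -Hp.
rewrite [froberg n 0 _]froberg_irrelevant ?addn0 ?binn; first by lia.
by move=> i; rewrite /upd; case: eqP.
Qed.

Lemma froberg_gt0 n d a : exact_dim n d a ->
  (forall p : 'I_s -> 'I_n.+1 -> K, 0 < \dim (fatsys p d a))%N ->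
  0 < froberg n d a.
Proof. by case/generic_ex => p <- /(_ p). Qed.

Lemma froberg_ge0 n d a : exact_dim n d a -> 0 <= froberg n d a.
Proof. by case/generic_ex => p <-. Qed.

Lemma relev_upd d a x : (a x <= d)%N ->
  #|relev d a| = #|relev d (upd a x d.+1)|.+1.
Proof.
move=> le_ax; rewrite (cardsD1 x (relev d a)) inE le_ax add1n; congr _.+1.
apply: eq_card => i; rewrite !inE /upd; case: eqP => // _.
by rewrite ltnn.
Qed.

(* Multiply a quadric through [T] by hyperplanes. *)
Lemma quadric_gt0 n (p : 'I_s -> 'I_n.+1 -> K) d a (T : {set 'I_s}) :
  (#|T| < 3 * n)%N -> (forall i, 1 < a i)%N ->
  (forall i, i \notin T -> 2 < a i)%N ->
  (\sum_i (if i \in T then d.+2 - a i else d.+3 - a i) <= n * d)%N ->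
  (0 < \dim (fatsys p d.+2 a))%N.
Proof.
move=> ltT a1 a2 sum_le.
(* Hence fewer than [3 * n] points always lie on a quadric. *)
have bin_ge k : (3 * k <= 'C(2 + k, 2))%N.
  by rewrite bin2 geq_half_double; case: k => [|[|k]]; rewrite -?muln2 /=; lia.
have Q0 : (0 < \dim (fatsys p 2 (fun i => if i \in T then 2 else 3)))%N.
  by have := fatsys_simple_ge p 2 T; have := bin_ge n; lia.
have R0 : (0 < \dim (fatsys p d (fun i => if i \in T then (a i).-1 else (a i).-2)))%N.
  apply: fatsys_hyperplanes => [i|].
    by case: ifPn => [_|/a2]; have := a1 i; lia.
  apply: leq_trans sum_le; apply: leq_sum => i _.
  by case: ifPn => [_|/a2]; have := a1 i; lia.
have -> : d.+2 = (2 + d)%N by [].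
apply: (fatsys_mul_gt0 Q0 R0) => i.
by case: ifPn => [_|/a2]; have := a1 i; lia.
Qed.

End Main.

(** * The induction *)

Lemma leq_card_arith S r n nd :
  (S + n + 2 <= nd -> S + r = n + nd -> n + n.+2 <= r)%N.
Proof. by lia. Qed.

Lemma leq_diff_arith n r : (n + n.+2 <= r -> n < r - n.+1)%N.
Proof. by lia. Qed.

Lemma leq_sub_arith k d u v :
  (u + v <= d -> (k == 0) || (d <= (d - v) + (d - u)))%N.
Proof. by move=> H; apply/orP; right; lia. Qed.

Lemma sum_contra_arith k A1 A2 B1 B2 X :
  (A1 <= B1 -> A2 <= B2 -> B1 + B2 <= X -> k.+1 + X <= A1 + A2 -> False)%N.
Proof. by lia. Qed.

Section Induction.
Variables (K : fieldType) (hK : [pchar K] =i pred0) (s : nat).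
Implicit Types (a : 'I_s -> nat) (x i j l : 'I_s).

Lemma sum_upd a x b e : (e <= b)%N ->
  (\sum_l (e - a l) = \sum_l (e - upd a x b l) + (e - a x))%N.
Proof.
move=> le_eb; rewrite (bigD1 x) //= [in RHS](bigD1 x) //= upd_eq (eqP le_eb).
rewrite add0n addnC; congr (_ + _)%N.
by apply: eq_bigr => l lx; rewrite upd_neq.
Qed.

Lemma card_relevD1 e a x : x \in relev e a ->
  #|relev e a| = #|relev e a :\ x|.+1.
Proof. by move=> xS; rewrite (cardsD1 x) xS. Qed.

Lemma leq_upd a x b : (a x <= b)%N -> forall i, (a i <= upd a x b i)%N.
Proof. by move=> le_b i; rewrite /upd; case: eqP => // ->. Qed.

Variables (n d : nat).
Hypothesis IHd : forall e a, (e < d)%N -> in_range n e a -> @exact_dim K s n e a.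

(** The other relevant points, at most [n], lie on a hyperplane missing [x], so [small_config_mul]
    applies with no relevant point left off it. *)
Lemma small_config_few a x :
  (forall a', (#|relev d a'| < #|relev d a|)%N -> in_range n d a' ->
     @exact_dim K s n d a') ->
  in_range n d a -> (#|relev d a| <= n.+1)%N -> x \in relev d a ->
  @small_config K s n d a.
Proof.
move=> IHs R few xS; have a0 := R.1.
have ax : (a x <= d)%N by rewrite inE in xS.
have ax0 := a0 x; have [e dE] : exists e, d = e.+1 by exists d.-1; lia.
pose A := relev d a :\ x.
pose a' i := if i \in A then a i else (a i).-1.
have a'x : a' x = (a x).-1 by rewrite /a' !inE eqxx.
have cA : #|relev d a| = #|A|.+1 by rewrite (cardsD1 x) xS.
have a'0 i : i != x -> (0 < a' i)%N.
  move=> ix; rewrite /a'; case: ifPn => [_|]; first exact: a0.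
  by rewrite !inE ix -ltnNge /=; lia.
have rel_a' (b : 'I_s -> nat) : (forall i, (a' i <= b i)%N) ->
    (#|relev e b| <= n.+1)%N.
  move=> le_b; apply: leq_trans few; apply: subset_leq_card.
  apply/subsetP => i; rewrite !inE; have := le_b i; rewrite /a'.
  by case: ifP => _; lia.
have lt_ed : (e < d)%N by rewrite dE.
have E1 : exact_dim K n d (upd a x d.+1).
  apply: IHs; first by rewrite (relev_upd ax).
  by apply: in_range_mono R; apply: leq_upd; lia.
have E2 : exact_dim K n e (upd a' x e.+2).
  apply: IHd => //; split; last by left; apply: rel_a'; apply: leq_upd; rewrite a'x; lia.
  by move=> i; rewrite /upd; case: eqP => // /eqP; apply: a'0.
have E3 : exact_dim K n e a'.
  have [a'x0|a'x0] := posnP (a' x); first exact: exact_dim_exp0 a'x0.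
  apply: IHd => //; split; last by left; apply: rel_a'.
  by move=> i; have [->|/a'0] := eqVneq i x.
have aA i : i != x -> ((i \in A) && (a' i == a i) ||
     (a i == (a' i).+1) && (d - a x < a' i))%N.
  move=> ix; rewrite /a'; case: ifPn => [_|]; first by rewrite eqxx.
  by rewrite !inE ix -ltnNge /= => ai; apply/andP; split; [apply/eqP|]; lia.
have xA : x \notin A by rewrite !inE eqxx.
have leA : (#|A| <= n)%N by lia.
clearbody A a'; move: E1 ax aA; rewrite dE => E1 ax aA.
apply: (@small_config_mul _ hK _ n e a a' x A) => //.
by rewrite a'x prednK.
Qed.

Hypothesis IHn :
  forall n', n = n'.+1 -> forall e a, in_range n' e a -> @exact_dim K s n' e a.

Section ManyPoints.
Variable a : 'I_s -> nat.
Hypothesis IHs : forall a', (#|relev d a'| < #|relev d a|)%N ->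
  in_range n d a' -> @exact_dim K s n d a'.
Hypothesis R : in_range n d a.
Hypothesis many : (n.+1 < #|relev d a|)%N.
Hypothesis a1 : forall i, (1 < a i)%N.

Lemma many_bounds : (\sum_i (d.+1 - a i) <= n * d.+1)%N /\
  (\sum_i (d - a i) + n + 2 <= n * d)%N.
Proof. by case: R => _ [|[R1 R2]]; lia. Qed.

Lemma exact_dim_drop x : (a x <= d)%N -> exact_dim K n d (upd a x d.+1).
Proof.
move=> ax; apply: IHs; first by rewrite (relev_upd ax).
by apply: in_range_mono R; apply: leq_upd; lia.
Qed.

(** In the residual system the points of [A] lose one multiplicity and the others keep theirs. As
    points of [A] have multiplicity at least 2, both sums drop by exactly [n]; the bound on the
    points off [A] prevents new points of full multiplicity. *)
Lemma small_config_reflex x (A : {set 'I_s}) :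
  x \in relev d a -> A \subset relev d a :\ x -> #|A| = n ->
  (forall c, c \in relev d a -> (a c <= a x)%N) ->
  (forall c, c \in (relev d a :\ x) :\: A -> (d.+1 < a x + a c)%N) ->
  (forall l, l \in A -> (a l < d)%N) ->
  (forall c, c \in (relev d a :\ x) :\: A -> (2 < a c)%N) ->
  @small_config K s n d a.
Proof.
move=> xS sA cA xmax hC hA hC2; have [R1 R2] := many_bounds.
have ax : (a x <= d)%N by rewrite inE in xS.
have xA : x \notin A by apply/negP => /(subsetP sA); rewrite !inE eqxx.
have [c cC] : exists c, c \in (relev d a :\ x) :\: A.
  apply/set0Pn; rewrite -card_gt0 cardsD (setIidPr sA) cA.
  by rewrite subn_gt0 -ltnS -card_relevD1.
have ac := hC2 c cC; have cS : c \in relev d a by move: cC; rewrite !inE => /and3P[].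
have ac2 := xmax c cS; have acd : (a c <= d)%N by rewrite inE in cS.
have ax0 := R.1 x.
have [e dE] : exists e, d = e.+1 by exists d.-1; lia.
pose a' i := if i \in A then a i else (a i).-1.
have a'x : a' x = (a x).-1 by rewrite /a' (negPf xA).
have offA i : i \notin A -> (2 < a i)%N.
  move=> iA; have [->|ix] := eqVneq i x; first by lia.
  have [iS|iS] := boolP (i \in relev d a).
    by apply: hC2; rewrite !inE in iS *; rewrite iA ix.
  by move: iS; rewrite inE -ltnNge; lia.
have R' : in_range n e a'.
  split=> [i|]; first by rewrite /a'; case: ifPn => [_|/offA]; have := a1 i; lia.
  have sumA (F G : 'I_s -> nat) : (forall i, F i = G i + (i \in A))%N ->
      (\sum_i F i = \sum_i G i + n)%N.
    move=> E; rewrite -cA -sum1_card [X in (_ + X)%N]big_mkcond -big_split /=.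
    by apply: eq_bigr => i _; rewrite E; case: (i \in A).
  right; split.
    have ones0 : #|ones a'| = 0%N.
      apply/eqP; rewrite cards_eq0; apply/eqP/setP => i; rewrite !inE.
      apply/negbTE/eqP; rewrite /a'; case: ifPn => [_|/offA]; have := a1 i; lia.
    have := sumA (fun i => d.+1 - a i)%N (fun i => e.+1 - a' i)%N.
    rewrite ones0 addn0 => sumE; move: R1; rewrite sumE ?dE ?mulnS; first by lia.
    move=> i; rewrite /a'; case: ifPn => [/hA|/offA]; rewrite ?dE; lia.
  have := sumA (fun i => d - a i)%N (fun i => e - a' i)%N.
  move=> sumE; move: R2; rewrite sumE ?dE ?mulnS; first by lia.
  move=> i; rewrite /a'; case: ifPn => [/hA|/offA]; rewrite ?dE; lia.
have lt_ed : (e < d)%N by rewrite dE.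
have E1 := exact_dim_drop ax.
have E3 := IHd lt_ed R'.
have E2 : exact_dim K n e (upd a' x e.+2).
  by apply: IHd => //; apply: in_range_mono R'; apply: leq_upd; rewrite a'x; lia.
move: E1 ax hC; rewrite dE => E1 ax hC.
apply: (@small_config_mul _ hK _ n e a a' x A) => //.
- by rewrite cA.
- by rewrite a'x prednK.
- move=> i ix; rewrite /a'; case: ifPn => [_|iA]; first by rewrite eqxx.
  have ai := offA i iA; apply/orP; right; apply/andP; split; first by apply/eqP; lia.
  have [iS|iS] := boolP (i \in relev e.+1 a).
    have := hC i; rewrite !inE in iS *; rewrite iA ix iS => /(_ isT); lia.
  by move: iS; rewrite inE -ltnNge; lia.
Qed.

(** All relevant points but at most [n - 1] are simple. It remains to see that the system without
    [x] is nonempty, by a quadric through [T] times hyperplanes. *)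
Lemma small_config_simple_top x (A : {set 'I_s}) l : (0 < n)%N ->
  x \in relev d a -> A \subset relev d a :\ x -> #|A| = n -> a x = d ->
  l \in A -> a l = d ->
  (forall c, c \in (relev d a :\ x) :\: A -> a c = d) ->
  @small_config K s n d a.
Proof.
move=> n0 xS sA cA ax lA al hC; have [R1 R2] := many_bounds.
have ax' : (a x <= d)%N by rewrite ax.
have E := exact_dim_drop ax'.
apply: (small_config_simple hK R.1 ax E); apply: froberg_gt0 E _ => p.
have xA : x \notin A by apply/negP => /(subsetP sA); rewrite !inE eqxx.
set C := (relev d a :\ x) :\: A in hC.
have cC : #|relev d a| = (n + #|C|).+1.
  rewrite (cardsD1 x) xS -(cardsID A (relev d a :\ x)) (setIidPr sA) cA.
  by rewrite -/C; lia.
(* With the [n] points of [A] this makes at most [3 * n - 1] points, the most a quadric is sure to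
   contain. *)
have [T' [sT' cT' _]] := @top_subset s (fun=> 0%N) C _ (geq_minr (2 * n).-1 #|C|).
pose T := A :|: T'.
have AT'0 : A :&: T' = set0.
  apply/setP => i; rewrite !inE; apply/negbTE/negP => /andP[iA /(subsetP sT')].
  by rewrite !inE iA.
have cT : #|T| = (n + #|T'|)%N by rewrite cardsU AT'0 cards0 subn0 cA.
have d2 : (1 < d)%N by rewrite -ax.
have cD : #|C :\: T'| = (#|C| - #|T'|)%N by rewrite cardsD (setIidPr sT').
have sumT : (\sum_i (if i \in T then d - upd a x d.+1 i
    else d.+1 - upd a x d.+1 i) <= n * (d - 2))%N.
  pose SA := (\sum_(i in A) (d - a i))%N.
  have le1 : (\sum_i (if i \in T then d - upd a x d.+1 i
      else d.+1 - upd a x d.+1 i) <= SA + #|C :\: T'|)%N.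
    have -> : (SA + #|C :\: T'| =
        \sum_i ((if i \in A then d - a i else 0) + (i \in C :\: T')))%N.
      rewrite big_split /= -big_mkcond -/SA; congr (_ + _)%N.
      rewrite -sum1_card big_mkcond; apply: eq_bigr => i _.
      by case: (i \in _).
    apply: leq_sum => i _; rewrite /upd !inE; have [->|ix] := eqVneq i x.
      by rewrite subnn (eqP (leqnSn d)); case: ifP.
    have [iA|iA] /= := boolP (i \in A); first exact: leq_addr.
    have [iT'|iT'] /= := boolP (i \in T').
      by rewrite (hC i) ?subnn // (subsetP sT').
    case: (leqP (a i) d) => [le_i|lt_i] /=; last by rewrite (eqP lt_i).
    by rewrite (hC i) ?subSnn // /C !inE iA ix le_i.
  apply: (leq_trans le1).
  (* If the quadric takes all of [C], only the points of [A] other than [l] need more, at most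
     [d - 2] each. If not, the many points of [C] make the bound on the sum strong enough. *)
  have [le_C|gt_C] := leqP #|C| (2 * n).-1.
    rewrite cD cT' (minn_idPr le_C) subnn addn0 /SA (bigD1 l) //= al subnn add0n.
    apply: (@leq_trans (\sum_(i in A | i != l) (d - 2))).
      by apply: leq_sum => i _; have := a1 i; lia.
    rewrite sum_nat_const leq_mul2r -cA; apply/orP; right.
    by apply: subset_leq_card; apply/subsetP => i /andP[].
  have SA_le : (SA <= \sum_i (d - a i))%N.
    by rewrite /SA [leqRHS](bigID (mem A)) /= leq_addr.
  move: R1; rewrite (sum_relev d a) cC cD cT' (minn_idPl (ltnW gt_C)) mulnBr mulnS.
  have : (n * 2 <= n * d)%N by rewrite leq_mul2l d2 orbT.
  lia.
have dE : d = (d - 2).+2 by lia.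
rewrite dE; apply: (@quadric_gt0 _ _ n p (d - 2) _ T); rewrite -?dE //.
- by rewrite cT cT'; lia.
- by move=> i; rewrite /upd; case: eqP => // _; lia.
move=> i; rewrite !inE /upd; case: (i =P x) => [_ _|/eqP ix]; first by lia.
rewrite negb_or => /andP[iA iT'].
have [iS|] := boolP (i \in relev d a); last first.
  by rewrite inE -ltnNge; apply: leq_ltn_trans.
have iC : i \in C by rewrite inE iA !inE ix; rewrite inE in iS.
rewrite (hC i iC) ltnNge; apply/negP => d_le.
move: sumT; have -> : (d - 2 = 0)%N by apply/eqP; rewrite subn_eq0.
rewrite muln0 leqn0 sum_nat_eq0 => /forallP/(_ i) /=.
rewrite inE (negPf iA) (negPf iT') /= upd_neq // (hC i iC) subSnn.
by [].
Qed.

(** Removing the simple point [x] makes the sum strictly smaller than [n * d.+1], so the traces on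
    the line through [i] and [j] are in range. They show that the system without [x] is nonempty. *)
Lemma small_config_double n' x i j : n = n'.+1 ->
  x \in relev d a -> a x = d -> i != j -> i != x -> j != x ->
  a i = 2%N -> a j = 2%N -> (2 < d)%N -> (\sum_l (d.+1 - a l) = n * d.+1)%N ->
  @small_config K s n d a.
Proof.
move=> nE xS ax ne_ij ix jx ai aj d3 sumE; have [_ R2] := many_bounds.
have ax' : (a x <= d)%N by rewrite ax.
have E := exact_dim_drop ax'; apply: (small_config_simple hK R.1 ax E).
set b := upd a x d.+1; have bi : b i = 2%N by rewrite /b upd_neq.
have bj : b j = 2%N by rewrite /b upd_neq.
have Rb : in_range n d b by apply: in_range_mono R; apply: leq_upd; lia.
have b1 l : (1 < b l)%N by rewrite /b /upd; case: eqP => // _; lia.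
have relb := relev_upd ax'; rewrite -/b in relb.
have sum1 := sum_upd a x (leqnn d.+1); rewrite -/b ax subSnn in sum1.
have sum0 := sum_upd a x (leqnSn d); rewrite -/b ax subnn addn0 in sum0.
have relE := sum_relev d a.
have [e dE] : exists e, d = e.+2 by exists d.-2; lia.
have many' : (n'.+2 < #|relev d b|)%N.
  move: R2 sumE relE; rewrite nE mulnS relb; lia.
have Rt t : (t < 2)%N -> in_range n' (d - t) (line_exp b i j d.+1 t).
  move=> t2; apply: in_range_line; rewrite ?bi ?bj -?nE //; first by lia.
  by rewrite -sumE sum1 addn1.
have E0 := IHn nE (Rt 0%N isT); have E1 := IHn nE (Rt 1%N isT).
have F0 := froberg_ge0 E0.
have F1 : 0 < froberg n' (d - 1) (line_exp b i j d.+1 1).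
  apply: froberg_gt0 E1 _ => p; apply: fatsys_hyperplanes.
    by move=> l; apply: (Rt 1%N isT).1.
  rewrite sum_line_exp //; last by lia.
  move: R2; rewrite sum0 (sum_split2 b d ne_ij) bi bj nE /=.
  have -> : (d - 1).+1 = d by lia.
  by rewrite mulSn mulnBr muln1; lia.
have ji : j != i by rewrite eq_sym.
rewrite nE dE (@froberg_line _ n' e.+1 b i j d.+1) ?bi ?bj //; last by lia.
rewrite (@froberg_line _ n' e (resid_exp b i j) i j d.+1) //; first last.
- by lia.
- by rewrite /resid_exp upd_eq bj.
- by rewrite /resid_exp upd_neq // upd_eq bi.
(* After two residuations the exponent at [j] is 0, so only the two traces contribute, one
   nonnegative and one positive. *)
rewrite [froberg n'.+1 e _](@froberg_exp0 _ _ _ _ j) ?addr0; last first.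
  by rewrite /resid_exp !upd_eq bj.
rewrite (@eq_froberg _ n' e.+2 _ (line_exp b i j d.+1 0)); last first.
  move=> l; left; rewrite /trace_exp /line_exp /upd double0 subn0.
  by case: eqP.
rewrite (@eq_froberg _ n' e.+1 _ (line_exp b i j d.+1 1)); last first.
  move=> l; left; rewrite /trace_exp /resid_exp /line_exp /upd (negPf ji) (negPf ne_ij).
  rewrite !eqxx bi bj; case: (l =P i) => // li; case: (l =P j) => // lj.
move: F0 F1; rewrite subn0 {1}dE; have -> : (d - 1 = e.+1)%N by lia.
by move=> F0 F1; apply: ltr_wpDl.
Qed.

Lemma small_config_many : @small_config K s n d a.
Proof.
have [R1 R2] := many_bounds.
have n0 : (0 < n)%N by rewrite lt0n; apply/eqP => n0; move: R2; rewrite n0; lia.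
have [n' nE] : exists n', n = n'.+1 by exists n.-1; lia.
have [/existsP[i /existsP[j /and4P[ne_ij iS aij sum_lt]]]|noB] :=
  boolP [exists i, exists j, [&& i != j, i \in relev d a, (a i + a j <= d.+1)%N &
    (\sum_l (d.+1 - a l) < n * d.+1)%N]].
  rewrite nE; apply: (@small_config_line _ hK _ n' d a i j ne_ij).
    by rewrite inE in iS; rewrite geq_min iS.
  move=> t; rewrite leq_min => /andP[ti tj]; apply: IHn => //.
  by apply: in_range_line; rewrite -?nE.
have sum_eq i j : i != j -> i \in relev d a -> (a i + a j <= d.+1)%N ->
    (\sum_l (d.+1 - a l) = n * d.+1)%N.
  move=> ne_ij iS aij; apply/eqP; rewrite eqn_leq R1 leqNgt; apply/negP => sum_lt.
  case/negP: noB; apply/existsP; exists i; apply/existsP; exists j.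
  exact/and4P.
have [x1 x1S] : exists x, x \in relev d a.
  by apply/set0Pn; rewrite -card_gt0; apply: leq_ltn_trans many.
case: (@arg_maxnP _ x1 (mem (relev d a)) a x1S) => x xS xmax.
have {}xS : x \in relev d a by [].
have ax : (a x <= d)%N by rewrite inE in xS.
have [|A [sA cA topA]] := @top_subset s (fun i => d.+1 - a i)%N (relev d a :\ x) n.
  by rewrite -ltnS -card_relevD1 // ltnW.
have xA : x \notin A by apply/negP => /(subsetP sA); rewrite !inE eqxx.
have topC l c : l \in A -> c \in (relev d a :\ x) :\: A -> (a l <= a c)%N.
  move=> lA /setDP[cS' cA']; have := topA l c lA cS' cA'.
  by move: cS'; rewrite !inE => /andP[_ ac]; lia.
(* Otherwise the sum is [n * d.+1] and there are at least [2 * n + 2] relevant points: [n.+1] at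
   least as fat as [c], and [n.+1] more at least as fat as [x], for a total of at least
   [n.+1 * d.+1]. *)
have hC c : c \in (relev d a :\ x) :\: A -> (d.+1 < a x + a c)%N.
  move=> cC; rewrite ltnNge; apply/negP => axc.
  have /setDP[/setD1P[cx cS'] cA'] := cC.
  have sumE := sum_eq x c _ xS axc; rewrite eq_sym cx in sumE; have {}sumE := sumE isT.
  pose B := c |: A; have cB : #|B| = n.+1 by rewrite cardsU1 cA' cA.
  have sB : B \subset relev d a.
    by rewrite subUset sub1set cS'; apply: subset_trans sA _; apply: subsetDl.
  have card_rel : (n + n.+2 <= #|relev d a|)%N.
    by move: R2 sumE; rewrite (sum_relev d a) mulnS; apply: leq_card_arith.
  have le1 : (n.+1 * (d.+1 - a c) <= \sum_(i in B) (d.+1 - a i))%N.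
    rewrite -cB -sum_nat_const; apply: leq_sum => i.
    by rewrite !inE => /predU1P[->|/topC/(_ cC) le_ic] //; apply: leq_sub2l.
  have le2 : (n.+1 * (d.+1 - a x) <= \sum_(i in relev d a :\: B) (d.+1 - a i))%N.
    apply: (@leq_trans (#|relev d a :\: B| * (d.+1 - a x))).
      rewrite leq_mul2r cardsD (setIidPr sB) cB; apply/orP; right.
      exact: leq_diff_arith.
    rewrite -sum_nat_const; apply: leq_sum => i /setDP[iS _].
    exact: leq_sub2l (xmax i iS).
  have : (\sum_(i in B) (d.+1 - a i) + \sum_(i in relev d a :\: B) (d.+1 - a i)
      <= \sum_l (d.+1 - a l))%N.
    rewrite [leqRHS](bigID (mem B)) /= leq_add2l.
    rewrite [leqRHS](bigID (mem (relev d a))) /= -[leqLHS]addn0 leq_add //.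
    by rewrite leq_eqVlt; apply/orP; left; apply/eqP; apply: eq_bigl => i; rewrite inE.
  rewrite sumE => le3.
  have : (n.+1 * d.+1 <= n.+1 * (d.+1 - a c) + n.+1 * (d.+1 - a x))%N.
    by rewrite -mulnDr leq_mul2l leq_sub_arith.
  by rewrite mulSn; apply: sum_contra_arith le1 le2 le3.
have [/existsP[l /andP[lA al]]|hA] := boolP [exists l, (l \in A) && (d <= a l)%N].
  have lS : l \in relev d a by have /setD1P[] := subsetP sA l lA.
  have ald : (a l <= d)%N by rewrite inE in lS.
  have axd : a x = d by apply/eqP; rewrite eqn_leq ax (leq_trans al (xmax l lS)).
  have {}al : a l = d by apply/eqP; rewrite eqn_leq ald al.
  apply: (@small_config_simple_top x A l) => // c cC.
  apply/eqP; rewrite eqn_leq -{2}al (topC l c lA cC) andbT.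
  by move: cC; rewrite !inE => /and3P[_ _].
have {}hA l : l \in A -> (a l < d)%N.
  by move=> lA; rewrite ltnNge; apply/negP => al; case/negP: hA;
     apply/existsP; exists l; rewrite lA.
(* A point off [A] of multiplicity [d - 1] forces all of [A] to have multiplicity [d - 1] and [x] to
   be simple. *)
have [/existsP[c /andP[cC ac]]|hC2] :=
    boolP [exists c, (c \in (relev d a :\ x) :\: A) && (a c <= 2)%N].
  have [l lA] : exists l, l \in A by apply/set0Pn; rewrite -card_gt0 cA.
  have ac2 : a c = 2%N by apply/eqP; rewrite eqn_leq ac a1.
  have al2 : a l = 2%N by apply/eqP; rewrite eqn_leq -{1}ac2 (topC l c lA cC) a1.
  have d3 : (2 < d)%N by rewrite -al2; apply: hA.
  have axd : a x = d.
    by apply/eqP; rewrite eqn_leq ax; have := hC c cC; rewrite ac2 addn2 !ltnS.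
  have /setDP[/setD1P[cx cS'] cA'] := cC.
  have /setD1P[lx lS] := subsetP sA l lA.
  have lc : l != c by apply: contraNneq cA' => <-.
  apply: (@small_config_double n' x l c) => //.
  by apply: (sum_eq l c) => //; rewrite al2 ac2 ltnS.
apply: (@small_config_reflex x A) => //.
move=> c cC; rewrite ltnNge; apply/negP => ac; case/negP: hC2.
by apply/existsP; exists c; rewrite cC.
Qed.

End ManyPoints.

(** With exponent 1 at [i] only the trace [t = 0] occurs, since the residual system is zero. *)
Lemma small_config_cone a i : in_range n d a -> (n.+1 < #|relev d a|)%N ->
  a i = 1%N -> @small_config K s n d a.
Proof.
move=> R many ai.
have [n' nE] : exists n', n = n'.+1.
  case: R => _ [|[_ R2]]; first by lia.
  by exists n.-1; move: R2; case: n => // ; lia.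
have d0 : (0 < d)%N.
  case: R => _ [|[_ R2]]; first by lia.
  by rewrite lt0n; apply/eqP => d0; move: R2; rewrite d0 muln0; lia.
have iS : i \in relev d a by rewrite inE ai.
have [j /setD1P[ji jS]] : exists j, j \in relev d a :\ i.
  by apply/set0Pn; rewrite -card_gt0 -ltnS -card_relevD1 //; lia.
have aj : (a j <= d)%N by rewrite inE in jS.
rewrite nE; apply: (@small_config_line _ hK _ n' d a i j); first by rewrite eq_sym.
  by lia.
move=> t; rewrite ai leq_min ltnS leqn0 => /andP[/eqP -> _]; rewrite subn0.
apply: IHn => //; apply: in_range_cone; rewrite -?nE //.
by rewrite eq_sym.
Qed.

Lemma exact_dim_step a : in_range n d a -> exact_dim K n d a.
Proof.
have [c] := ubnP #|relev d a|; elim: c a => // c IHc a; rewrite ltnS => le_c R.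
have IHs a' : (#|relev d a'| < #|relev d a|)%N -> in_range n d a' ->
    exact_dim K n d a'.
  by move=> lt_a'; apply: IHc; apply: leq_trans le_c.
have [S0|[x xS]] := set_0Vmem (relev d a).
  apply: exact_dim_irrelevant => i; rewrite ltnNge; apply/negP => ai.
  by have := in_set0 i; rewrite -S0 inE ai.
have ax : (a x <= d)%N by rewrite inE in xS.
have Rx : in_range n d (upd a x d.+1).
  by apply: in_range_mono R; apply: leq_upd; apply: leqW.
apply: (exact_dim_of hK ax (ltnSn d)).
- by apply: IHs => //; rewrite (relev_upd ax).
- apply: IHd; last exact: in_range_deg (leq_subr (a x) d) Rx.
  by rewrite ltn_subrL (R.1 x) (leq_trans (R.1 x) ax).
have [few|many] := leqP #|relev d a| n.+1.
  exact: (small_config_few IHs R few xS).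
have [/existsP[i /eqP ai]|no1] := boolP [exists i, a i == 1%N].
  exact: (small_config_cone R many ai).
apply: (small_config_many IHs R many) => i.
have := R.1 i; rewrite leq_eqVlt => /predU1P[E|//].
by case/negP: no1; apply/existsP; exists i; rewrite -E.
Qed.

End Induction.

Theorem in_range_exact (K : fieldType) (hK : [pchar K] =i pred0) s n d
    (a : 'I_s -> nat) : in_range n d a -> exact_dim K n d a.
Proof.
elim: n d a => [|n IHn] d; elim/ltn_ind: d => d IHd a.
  by apply: exact_dim_step => // e b /IHd; apply.
apply: exact_dim_step => // [e b /IHd|n' [<-] //]; apply.
Qed.

(** * Comparison with [linsys_dim_at] *)

Section LinearSystem.
Variables (K : fieldType) (hK : [pchar K] =i pred0) (n d s : nat).
Variables (m : 'I_s -> nat) (p : 'I_s -> 'I_n.+1 -> K).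
Hypothesis le_md : forall i, (m i <= d)%N.
Let V := fatsys p d (fun i => d.+1 - m i)%N.

Lemma in_linsys_fatsys (f : dhomog n.+1 K d) : in_linsys d m p (val f) <-> f \in V.
Proof.
have fH := dhomog_is_dhomog f; split=> [[_ van]|/fatsysP H].
  by apply/fatsysP => i; apply/(vanishes_dder hK _ fH (le_md i)).
by split=> // i; apply/(vanishes_dder hK _ fH (le_md i)).
Qed.

Lemma linsys_dim_fatsys : linsys_dim_at d m p ((\dim V)%:Z - 1).
Proof.
exists (\dim V); split=> //; split=> [|[Ps [PsL Ps_free]]].
  exists (fun j => val (vbasis V)`_j); split=> [j|c c0].
    by apply/in_linsys_fatsys; rewrite vbasis_mem // mem_nth // size_tuple.
  have /freeP := basis_free (vbasisP V); apply.
  by apply: val_inj; rewrite -[RHS]c0 raddf_sum.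
pose X := [tuple DHomog (PsL j).1 | j < (\dim V).+1].
have XE (j : 'I_(\dim V).+1) : X`_j = DHomog (PsL j).1.
  by rewrite -tnth_nth tnth_mktuple.
have freeX : free X.
  apply/freeP => c c0; apply: Ps_free; rewrite -[RHS](congr1 val c0) raddf_sum.
  by apply: eq_bigr => j _; rewrite XE.
have XV : (<<X>> <= V)%VS.
  apply/span_subvP => f /tnthP[j ->]; rewrite tnth_mktuple.
  by apply/in_linsys_fatsys; apply: PsL.
have := dimvS XV; rewrite (eqP freeX) size_tuple.
by rewrite ltnn.
Qed.

End LinearSystem.

Theorem theorem5p3 (K : closedFieldType) (hK : [pchar K] =i pred0)
    (n d s : nat) (m : 'I_s -> nat)
    (hn : (1 <= n)%N) (hd : (2 <= d)%N) (hs : (n + 3 <= s)%N)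
    (hm_dec : forall i j : 'I_s, (i <= j)%N -> (m j <= m i)%N)
    (hm_le : forall i, (m i <= d)%N) (hm_ge : forall i, (1 <= m i)%N) :
    let sd := #|[set i | m i == d]| in
    let b := Num.min (n%:Z - sd%:Z) (s%:Z - n%:Z - 2) in
    (\sum_(i < s) (m i)%:Z <= n%:Z * d%:Z + b) ->
    forall D : int, is_ldim n d m D -> @general_dim K n d s m D.
Proof.
move=> sd b sum_le D HD; pose a i := (d.+1 - m i)%N.
have range_a : in_range n d a.
  split=> [i|]; first by rewrite /a; have := hm_le i; lia.
  have sumE : (\sum_i (d.+1 - a i) = \sum_i m i)%N.
    by apply: eq_bigr => i _; rewrite subKn // leqW.
  have cardE : #|relev d a| = s.
    rewrite -[RHS]card_ord -cardsT; apply: eq_card => i; rewrite !inE /a.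
    by have := hm_ge i; lia.
  have onesE : #|ones a| = sd.
    apply: eq_card => i; rewrite !inE /a; have := hm_le i; lia.
  have sum1 := sum_relev d a; rewrite cardE sumE in sum1.
  move: sum_le; rewrite -(big_morph Posz PoszD (erefl _)) -PoszM /b => sum_le.
  right; rewrite onesE sumE mulnS; move: sum_le sum1; clearbody sd.
  by move: (\sum_i m i)%N (\sum_i (d - a i))%N (n * d)%N => S S' nd; split; lia.
(* Smaller multiplicities stay in range, so the containing systems in the definition of [is_ldim]
   are also exact. *)
have exact_a' m' : (forall i, m' i <= m i)%N ->
    exact_dim K n d (fun i => d.+1 - m' i)%N.
  move=> le_m'; apply: in_range_exact => //; apply: in_range_mono range_a => i.
  by rewrite /a; have := le_m' i; lia.
have exact_a := exact_a' m (fun=> leqnn _).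
have dimE : D = froberg n d a - 1.
  have [p0 Fp0] := generic_ex exact_a; case: HD => [[[m' [le_m']]]|[_ ->]].
    have le_m'd i : (m' i <= d)%N by apply: leq_trans (hm_le i).
    rewrite ldim_virt_froberg // => F_lt ->.
    (* A negative virtual dimension means that the containing system, being exact, is zero; hence so
       is the given one. *)
    have [p [H1 H2]] := generic_ex (generic_and hK exact_a (exact_a' m' le_m')).
    rewrite -H1; have -> : \dim (fatsys p d a) = 0%N; last by [].
    apply/eqP; rewrite -leqn0.
    apply: (@leq_trans (\dim (fatsys p d (fun i => d.+1 - m' i)%N))).
      apply: dimvS; apply/subvP => f /fatsysP fV; apply/fatsysP => i.
      by apply: dder_eq0_leq (fV i); apply: leq_sub2l.
    by move: F_lt; rewrite -H2; lia.
  (* As [froberg n d a] is a dimension, the maximum with [-1] is the virtual dimension itself. *)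
  by rewrite ldim_virt_froberg // -Fp0; lia.
have [G [[v0 Gv0] GQ]] := exact_a; exists G; split.
  by apply: contraNneq Gv0 => ->; rewrite meval0.
by move=> v /GQ dimV; rewrite dimE -dimV; apply: linsys_dim_fatsys.
Qed.
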